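(* Let $1\le p\le\infty$ with conjugate exponent $p'$, let $u,v\in L_g^p([a,b))$, and let $u_a,u_b\in\mathbb F$. The following statements are equivalent: (i) for every $\Phi\in\mathcal W_g^{1,p'}([a,b])$, $$\int_{[a,b)}u\,D_g\Phi\,d\mu_g+\int_{[a,b)}v\,S_g\Phi\,d\mu_g=u_b\Phi(b)-u_a\Phi(a);$$ (ii) the function $U(t):=u_a+\int_{[a,t)}v\,d\mu_g$, $t\in[a,b]$, belongs to $\mathcal W_g^{1,p}([a,b])$, satisfies $U=u$ $\mu_g$-almost everywhere, and fulfills both trace conditions $U(a)=u_a$ and $U(b)=u_b$. In this case, $D_gU=v$ $\mu_g$-almost everywhere and the representative $U$ (an element of $\mathcal W_g^{1,p}([a,b])$ equal to $u$ $\mu_g$-a.e. with $U(a)=u_a$, $U(b)=u_b$) is unique.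
   Context: Let $\mathbb F$ be $\mathbb R$ or $\mathbb C$, let $a<b$ be real, and let $g:[a,b]\to\mathbb R$ be nondecreasing and left-continuous. $\mu_g$ is the finite Lebesgue--Stieltjes measure on $[a,b)$ with $\mu_g([s,t))=g(t)-g(s)$ for $a\le s\le t\le b$. Standing assumption: $M_g:=\mu_g([a,b))=g(b)-g(a)>0$. For $1\le p\le\infty$, $L_g^p([a,b))$ is the $L^p$ space of $\mathbb F$-valued functions for the completion of $\mu_g$ (modulo $\mu_g$-a.e. equality). $J_g:=\{t\in[a,b):\Delta g(t):=g(t^+)-g(t)>0\}$ is the set of jump points, so $\mu_g(\{t\})=\Delta g(t)$ for $t\in J_g$. Conjugate exponents: $1/p+1/p'=1$, with $1'=\infty$, $\infty'=1$. $AC_g([a,b])$ is the set of $u:[a,b]\to\mathbb F$ such that for every $\varepsilon>0$ there is $\delta>0$ such that, for every finite family of pairwise disjoint intervals $[a_j,b_j)\subset[a,b)$, $\sum_j(g(b_j)-g(a_j))<\delta$ implies $\sum_j|u(b_j)-u(a_j)|<\varepsilon$. It is known that $u\in AC_g([a,b])$ if and only if there is $v\in L_g^1([a,b))$ with $u(t)=u(a)+\int_{[a,t)}v\,d\mu_g$ for all $t\in[a,b]$; $v$ is unique $\mu_g$-a.e. and the Stieltjes derivative is $D_gu:=v$. $\mathcal W_g^{1,p}([a,b]):=\{U\in AC_g([a,b]): U|_{[a,b)}\in L_g^p([a,b)),\ D_gU\in L_g^p([a,b))\}$. Posterior trace: for $u\in AC_g([a,b])$, $S_gu(t):=u(t^+)$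 if $t\in J_g$ and $S_gu(t):=u(t)$ if $t\notin J_g$. *)

(* Defs.v *)
From HB Require Import structures.
From mathcomp Require Import all_boot all_order all_algebra.
From mathcomp Require Import complex.
From mathcomp Require Import all_classical all_reals all_analysis.

Set Implicit Arguments.
Unset Strict Implicit.
Unset Printing Implicit Defensive.

Import Order.TTheory GRing.Theory Num.Theory.
Import numFieldNormedType.Exports.

Local Open Scope classical_set_scope.
Local Open Scope ring_scope.

Variant scalar_kind := RealScalars | ComplexScalars.

Definition scalar_field (R : realType) (k : scalar_kind) : numFieldType :=
  match k with
  | RealScalars => (R : numFieldType)
  | ComplexScalars => (R[i] : numFieldType)
  end.

Section scalars.
Variable R : realType.

Definition scalar_re (k : scalar_kind) : scalar_field R k -> R :=
  match k with
  | RealScalars => fun x : R => x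
  | ComplexScalars => fun z : R[i] => complex.Re z
  end.

Definition scalar_im (k : scalar_kind) : scalar_field R k -> R :=
  match k with
  | RealScalars => fun=> 0
  | ComplexScalars => fun z : R[i] => complex.Im z
  end.

(* The second argument is discarded for real scalars. *)
Definition mk_scalar (k : scalar_kind) : R -> R -> scalar_field R k :=
  match k with
  | RealScalars => fun x _ => x
  | ComplexScalars => fun x y => Complex x y
  end.

(* The norm of a [numFieldType] takes its values in the field itself; this is
   the same number seen in [R]. *)
Definition modulus (k : scalar_kind) (z : scalar_field R k) : R := scalar_re `|z|.

End scalars.

(* Values outside [a, b] are irrelevant. *)
Record derivator (R : realType) (a b : R) := Derivator {
  derivator_fun :> R -> R ;
  derivator_lt : a < b ;
  derivator_nd : {in `[a, b] &, {homo derivator_fun : s t / s <= t}} ;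
  derivator_lc : forall t, t \in `]a, b] ->
    derivator_fun x @[x --> t^'-] --> derivator_fun t }.

Section stieltjes.
Variables (R : realType) (a b : R) (g : derivator a b).

Definition clamp (t : R) : R := Num.max a (Num.min t b).

(* The library builds Lebesgue-Stieltjes measures from right-continuous
   functions, with mass f t - f s on ]s, t]. We extend g by constants outside
   [a, b], reflect it into a right-continuous function, and transport the
   resulting measure back along x |-> - x. *)
Definition reflection (x : R) : R := - g (clamp (- x)).

Lemma clamp_itv t : clamp t \in `[a, b].
Proof.
have ab := derivator_lt g.
by rewrite in_itv /clamp /= le_max lexx /= ge_max ge_min lexx orbT (ltW ab).
Qed.

Lemma clamp_id t : t \in `[a, b] -> clamp t = t.
Proof. by rewrite in_itv /clamp /= => /andP[at_ /min_idPl ->]; apply/max_idPr. Qed.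

Lemma clamp_homo : {homo clamp : s t / s <= t}.
Proof.
move=> s t st; rewrite /clamp ge_max le_max lexx /= le_max.
by apply/orP; right; rewrite le_min !ge_min st lexx orbT.
Qed.

Lemma extension_lc t : g (clamp x) @[x --> t^'-] --> g (clamp t).
Proof.
have ab := derivator_lt g.
have [ta|ta] := leP t a.
  have E x : x <= a -> clamp x = a.
    by move=> xa; rewrite /clamp; apply/max_idPl; rewrite ge_min xa.
  rewrite E//; apply: (@cvg_trans _ (cst (g a) @ t^'-)); last exact: cvg_cst.
  apply: near_eq_cvg; near=> x; rewrite /= E//.
  by apply: (le_trans _ ta); apply: ltW; near: x; exact: nbhs_left_lt.
have [tb|bt] := leP t b.
  rewrite [in X in _ --> X]clamp_id; last by rewrite in_itv /= (ltW ta) tb.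
  apply: (@cvg_trans _ (g x @[x --> t^'-])); last first.
    by apply: derivator_lc; rewrite in_itv /= ta tb.
  apply: near_eq_cvg; near=> x; rewrite /= clamp_id// in_itv /=; apply/andP; split.
    by apply: ltW; near: x; exact: nbhs_left_gt.
  by apply: (le_trans _ tb); apply: ltW; near: x; exact: nbhs_left_lt.
have E x : b <= x -> clamp x = b.
  by move=> xb; rewrite /clamp (min_idPr xb); apply/max_idPr; exact: ltW.
rewrite E ?ltW//; apply: (@cvg_trans _ (cst (g b) @ t^'-)); last exact: cvg_cst.
apply: near_eq_cvg; near=> x; rewrite /= E//.
by apply: ltW; near: x; exact: nbhs_left_gt.
Unshelve. all: by end_near. Qed.

Lemma reflection_nd : nondecreasing reflection.
Proof.
move=> s t st; rewrite /reflection lerN2; apply: derivator_nd.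
- exact: clamp_itv.
- exact: clamp_itv.
- by apply: clamp_homo; rewrite lerN2.
Qed.

Lemma reflection_rc : right_continuous reflection.
Proof.
move=> t; apply: cvgN.
apply/(cvg_at_rightNP (fun x => g (clamp (- x)))).
rewrite [X in X @ _ --> _](_ : _ = g \o clamp); first exact: extension_lc.
by apply/funext => x /=; rewrite opprK.
Qed.

HB.instance Definition _ :=
  isCumulative.Build R _ R reflection reflection_nd reflection_rc.

Definition stieltjes_measure : set (measurableTypeR R) -> \bar R :=
  pushforward (lebesgue_stieltjes_measure reflection)
    (-%R : measurableTypeR R -> measurableTypeR R).

Let opp_meas : measurable_fun setT (-%R : measurableTypeR R -> measurableTypeR R).
Proof. by []. Qed.

Let m : {measure set (measurableTypeR R) -> \bar R} :=
  measure_function_pushforward__canonical__measure_function_Measure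
    (lebesgue_stieltjes_measure reflection) opp_meas.

HB.instance Definition _ := Measure.copy stieltjes_measure m.


Lemma stieltjes_measure_itv s t : s \in `[a, b] -> t \in `[a, b] -> s <= t ->
  stieltjes_measure `[s, t[%classic = (g t - g s)%:E.
Proof.
move=> sab tab st.
rewrite /stieltjes_measure /pushforward opp_preimage_itvbndbnd/=.
rewrite /lebesgue_stieltjes_measure /measure_extension/=.
rewrite measurable_mu_extE/=; last exact: is_ocitv.
rewrite wlength_itv_bnd ?lerN2// /reflection !opprK !clamp_id//.
by rewrite addrC.
Qed.

End stieltjes.

Section completion.
Variables (R : realType) (a b : R) (g : derivator a b).

(* R with the sigma-algebra of the sets measurable for the outer measure of
   mu_g; as mu_g is finite this is the completion of the Borel sigma-algebra. *)
Definition stieltjes_type := caratheodory_type ((stieltjes_measure g)^*)%mu.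

Definition completed_stieltjes_measure : set stieltjes_type -> \bar R :=
  @completed_measure_extension _ _ _ (stieltjes_measure g).

HB.instance Definition _ := Measurable.on stieltjes_type.
HB.instance Definition _ := Measure.on completed_stieltjes_measure.

End completion.
Arguments completed_stieltjes_measure {R a b} g.

Section function_spaces.
Variables (R : realType) (k : scalar_kind) (a b : R) (g : derivator a b).
Local Notation K := (scalar_field R k).
Local Notation mu := (completed_stieltjes_measure g).

(* Functions on [a, b) or [a, b] are represented by total functions; only their
   values on that interval matter. *)
Implicit Types (p : \bar R) (f w U : R -> K) (D : set R).

Definition Lp_g p f : Prop :=
  [/\ measurable_fun (`[a, b[%classic : set (stieltjes_type g))
        (fun t => scalar_re (f t)),
      measurable_fun (`[a, b[%classic : set (stieltjes_type g))
        (fun t => scalar_im (f t))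
    & finite_norm mu p ((fun t => modulus (f t)) \_ `[a, b[) ].

Definition integral_g D f : K :=
  mk_scalar k (\int[mu]_(t in D) scalar_re (f t))
              (\int[mu]_(t in D) scalar_im (f t)).

Definition ae_eq_g f w : Prop := {ae mu, forall t, t \in `[a, b[ -> f t = w t}.

(* The intervals [s j, t j) are taken non-empty, so that the inclusion in [a, b)
   does constrain the end points: a <= s j and t j <= b. *)
Definition AC_g U : Prop :=
  forall eps : R, 0 < eps -> exists2 delta : R, 0 < delta &
    forall (n : nat) (s t : 'I_n -> R),
      (forall j, s j < t j) ->
      (forall j, `[s j, t j[ `<=` `[a, b[) ->
      trivIset setT (fun j => `[s j, t j[%classic) ->
      \sum_(j < n) (g (t j) - g (s j)) < delta ->
      \sum_(j < n) modulus (U (t j) - U (s j)) < eps.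

(* [is_stieltjes_deriv U w] : w is a version of the Stieltjes derivative D_g U,
   which is only defined up to mu_g-a.e. equality.  Hence "D_g U is in L^p"
   reads: D_g U has a version in L^p. *)
Definition is_stieltjes_deriv U w : Prop :=
  Lp_g 1 w /\
  forall t, t \in `[a, b] -> U t = U a + integral_g `[a, t[ w.

Definition W1p_g p U : Prop :=
  [/\ AC_g U, Lp_g p U & exists2 w, is_stieltjes_deriv U w & Lp_g p w].

(* For t in [a, b) the right limit only involves values on [a, b]. *)
Definition jumps_g : set R :=
  [set t | (t \in `[a, b[) /\ 0 < lim (g x @[x --> t^'+]) - g t].

Definition posterior_trace U (t : R) : K :=
  if t \in jumps_g then lim (U x @[x --> t^'+]) else U t.

End function_spaces.

(* Main.v *)
From HB Require Import structures.
Require Import Defs.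
From mathcomp Require Import all_boot all_order all_algebra.
From mathcomp Require Import complex.
From mathcomp Require Import all_classical all_reals all_analysis.
From mathcomp Require Import measurable_realfun ess_sup_inf.
From mathcomp Require Import lra ring.

(* Integration by parts, [V Phi]_a^b = int V dPhi + int dV S Phi, is Fubini's
   theorem on the square [a, b)^2 cut along the diagonal: the points s < t give
   the first integral and the points t <= s the second, which is where the
   posterior trace S Phi (t) = Phi (a) + int_[a, t] D Phi comes from.  It yields
   (ii) => (i) at once.  Conversely, subtracting it from (i) leaves
   int (u - U) D Phi = (u_b - U b) Phi(b).  Taking for D Phi the indicator of a
   measurable set and choosing Phi(a) so that Phi(b) = 0 gives u = U a.e.; then
   D Phi = 0 and Phi = 1 give U b = u_b.  Only bounded D Phi are tested, so no
   Hoelder inequality is needed.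

   For the uniqueness of the representative, two AC_g functions that agree a.e.
   agree, for any t with g t < g b and any delta > 0, at some s >= t with
   g s - g t < delta; if g t = g b, the trace at b plays the role of s.  Absolute
   continuity then transfers the equality to t. *)

Set Implicit Arguments.
Unset Strict Implicit.
Unset Printing Implicit Defensive.

Import Order.TTheory GRing.Theory Num.Theory.
Import numFieldNormedType.Exports.

Local Open Scope classical_set_scope.
Local Open Scope ring_scope.

(** * Real and complex scalars *)

Section scalar.
Variables (R : realType) (k : scalar_kind).
Local Notation K := (scalar_field R k).
Implicit Types (z w : K) (x y : R).

Lemma scalar_eq z w : scalar_re z = scalar_re w -> scalar_im z = scalar_im w -> z = w.
Proof. by case: k z w => //= -[x y] [x' y'] /= -> ->. Qed.

Lemma scalar_reD z w : scalar_re (z + w) = scalar_re z + scalar_re w.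
Proof. by case: k z w => //= -[x y] [x' y']. Qed.

Lemma scalar_imD z w : scalar_im (z + w) = scalar_im z + scalar_im w.
Proof. by case: k z w => [z w|[x y] [x' y']] //=; rewrite addr0. Qed.

Lemma scalar_reN z : scalar_re (- z) = - scalar_re z.
Proof. by case: k z => //= -[x y]. Qed.

Lemma scalar_imN z : scalar_im (- z) = - scalar_im z.
Proof. by case: k z => [z|[x y]] //=; rewrite oppr0. Qed.

Lemma scalar_reM z w :
  scalar_re (z * w) = scalar_re z * scalar_re w - scalar_im z * scalar_im w.
Proof. by case: k z w => [z w|[x y] [x' y']] //=; rewrite mul0r subr0. Qed.

Lemma scalar_imM z w :
  scalar_im (z * w) = scalar_re z * scalar_im w + scalar_im z * scalar_re w.
Proof. by case: k z w => [z w|[x y] [x' y']] //=; rewrite mul0r mulr0 addr0. Qed.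

Lemma scalar_re_mk x y : scalar_re (mk_scalar k x y) = x.
Proof. by case: k. Qed.

Lemma scalar_im_mk0 x : scalar_im (mk_scalar k x 0) = 0.
Proof. by case: k. Qed.

Lemma norm_scalar_le_modulus z :
  (`|scalar_re z| <= modulus z) * (`|scalar_im z| <= modulus z).
Proof.
rewrite /modulus; case: k z => [z|[x y]]; first by rewrite /= normr0.
rewrite normc_def /=; split; rewrite -sqrtr_sqr ler_wsqrtr// ?lerDl ?lerDr sqr_ge0//.
Qed.

Lemma modulus_le z : modulus z <= `|scalar_re z| + `|scalar_im z|.
Proof.
rewrite /modulus; case: k z => [z|[x y]]; first by rewrite /= normr0 addr0.
rewrite normc_def /=.
rewrite -[leRHS]ger0_norm ?addr_ge0// -[leRHS]sqrtr_sqr ler_wsqrtr//.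
by rewrite sqrrD !real_normK ?num_real// lerD2r lerDl mulrn_wge0// mulr_ge0.
Qed.

Lemma modulus_ge0 z : 0 <= modulus z.
Proof. exact: le_trans (norm_scalar_le_modulus z).1. Qed.

(** Balls in [K] have radii in [K], but a positive complex number is a positive real one, so real
    radii suffice. *)
Lemma modulus_cvg T (F : set_system T) (f : T -> K) (l : K) : Filter F ->
  (forall e, 0 < e -> \forall x \near F, modulus (f x - l) < e) -> f @ F --> l.
Proof.
move=> FF fl; apply/cvgrPdist_lt => e e0.
have [r r0 er] : exists2 r : R, 0 < r & forall w, modulus w < r -> `|w| < e.
  rewrite /modulus; case: k e e0 {f l fl} => /= [e e0|[x y]].
    by exists e => // w; rewrite normr_id.
  rewrite ltcE/= => /andP[/eqP -> x0]; exists x => // -[u v]/=.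
  by rewrite ltcE/= eqxx/=.
by apply: filterS (fl r r0) => x; rewrite distrC; exact: er.
Qed.
End scalar.

(** * The completed Stieltjes measure *)

Section completed_stieltjes.
Variables (R : realType) (a b : R) (g : derivator a b).
Local Notation mu := (completed_stieltjes_measure g).
Local Notation T := (stieltjes_type g).

Lemma borel_completed (B : set R) :
  measurable (B : set (measurableTypeR R)) -> measurable (B : set T).
Proof. exact: caratheodory_measurable_mu_ext. Qed.

Lemma completed_stieltjes_measure_borel (B : set R) :
  measurable (B : set (measurableTypeR R)) ->
  mu B = stieltjes_measure g B.
Proof. exact: measurable_mu_extE. Qed.

Lemma measurable_itvT (i : interval R) : measurable ([set` i] : set T).
Proof. by apply: borel_completed; exact: measurable_itv. Qed.

(** Reflection turns [s, t) into ]- t, - s], where [reflection] gives the mass. The end points range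
    over the whole line because the total mass is computed from the intervals [- n, n). *)
Lemma stieltjes_measure_clamp s t : s <= t ->
  mu `[s, t[%classic = (g (clamp a b t) - g (clamp a b s))%:E.
Proof.
move=> st; rewrite completed_stieltjes_measure_borel//.
rewrite /stieltjes_measure /pushforward opp_preimage_itvbndbnd/=.
rewrite /lebesgue_stieltjes_measure /measure_extension/=.
rewrite measurable_mu_extE/=; last exact: is_ocitv.
by rewrite wlength_itv_bnd ?lerN2// /reflection !opprK addrC.
Qed.

Lemma completed_measure_itv s t : s \in `[a, b] -> t \in `[a, b] -> s <= t ->
  mu `[s, t[%classic = (g t - g s)%:E.
Proof. by move=> sab tab st; rewrite stieltjes_measure_clamp// !clamp_id. Qed.

(** The intervals [- n, n) increase to the line and each has mass at most g b - g a; continuity from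
    below gives the same bound for the line. *)
Lemma completed_stieltjes_measureT : (mu [set: R] < +oo)%E.
Proof.
have ab := derivator_lt g.
pose F n : set T := `[- n%:R, n%:R[%classic.
have FT : \bigcup_n F n = [set: T].
  apply/seteqP; split => // x _.
  exists (Num.truncn `|x|).+1 => //; rewrite /F /= in_itv/=.
  have := truncnS_gt `|x|; rewrite ltr_norml => /andP[? ->]; rewrite andbT.
  exact: ltW.
have ndF : nondecreasing_seq F.
  move=> m n mn; apply/subsetPset => x; rewrite /F/= !in_itv/= => /andP[mx xm].
  by rewrite (le_trans _ mx) ?lerN2 ?ler_nat//= (lt_le_trans xm)// ler_nat.
have := nondecreasing_cvg_mu (mu := mu) (fun n => measurable_itvT _)
  (bigcupT_measurable F (fun n => measurable_itvT _)) ndF.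
rewrite FT => /cvg_lim <-//.
apply: (@le_lt_trans _ _ (g b - g a)%:E); last exact: ltry.
apply: lime_le; first by apply: ereal_nondecreasing_is_cvgn => m n mn;
  rewrite /= le_measure ?inE//; [exact: measurable_itvT..|exact/subsetPset/ndF].
apply: nearW => n /=; rewrite /F stieltjes_measure_clamp; last first.
  by rewrite (@le_trans _ _ 0)// oppr_le0.
have aab : a \in `[a, b] by rewrite in_itv/= lexx ltW.
have bab : b \in `[a, b] by rewrite in_itv/= lexx ltW.
have cl x := clamp_itv g x; rewrite lee_fin lerB//; apply: derivator_nd => //.
  by move: (cl n%:R); rewrite in_itv/= => /andP[].
by move: (cl (- n%:R)); rewrite in_itv/= => /andP[].
Qed.

Let fin_mu : fin_num_fun mu.
Proof. exact: lty_fin_num_fun completed_stieltjes_measureT. Qed.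

HB.instance Definition _ := Measure_isFinite.Build _ _ _ mu fin_mu.

Lemma ae_completed_filter : Filter (almost_everywhere mu).
Proof. exact: ae_filter_ringOfSetsType. Qed.

End completed_stieltjes.

(** * Fubini's theorem for kernels supported on a set *)

Section product_kernel.
Context d (T : measurableType d) (R : realType).
Variable mu : {sigma_finite_measure set T -> \bar R}.
Variables f h : T -> R.
Hypothesis intf : mu.-integrable setT (EFin \o f).
Hypothesis inth : mu.-integrable setT (EFin \o h).
Variable A : set (T * T).
Hypothesis mA : measurable A.

Let mf : measurable_fun setT f.
Proof. exact/measurable_EFinP/(measurable_int _ intf). Qed.

Let mh : measurable_fun setT h.
Proof. exact/measurable_EFinP/(measurable_int _ inth). Qed.

(** The kernel is dominated by |h(t)| |f(s)|, whose iterated integral factors into the product of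
    two finite integrals. *)
Lemma integrable_kernel : (mu \x mu)%E.-integrable setT
  (EFin \o (fun x : T * T => h x.1 * (f x.2 * \1_A x))).
Proof.
have m1 : measurable_fun setT (fun x : T * T => h x.1 * f x.2).
  by apply: measurable_funM; apply: measurableT_comp.
apply: (@le_integrable _ _ _ (mu \x mu)%E setT _ _
    (EFin \o (fun x : T * T => h x.1 * f x.2))) => //.
- apply/measurable_EFinP; apply: measurable_funM.
    exact: measurableT_comp.
  by apply: measurable_funM => //; exact: measurableT_comp.
- move=> x _ /=; rewrite lee_fin mulrA normrM ler_piMr// indicE.
  by case: (x \in A); rewrite ?normr1 ?normr0.
apply/integrable12ltyP; first exact/measurable_EFinP.
under eq_integral do under eq_integral do rewrite /= normrM EFinM.
have [_ f_lty] := integrableP _ _ _ intf.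
under eq_integral => t _.
  rewrite ge0_integralZl_EFin//; last first.
    by apply/measurable_EFinP; exact: measurableT_comp.
  over.
rewrite ge0_integralZr//=; last 2 first.
  by apply/measurable_EFinP; exact: measurableT_comp.
  by apply: integral_ge0.
have [_ h_lty] := integrableP _ _ _ inth.
apply: lte_mul_pinfty => //; first by apply: integral_ge0.
by rewrite ge0_fin_numE//; apply: integral_ge0.
Qed.

Let integrable_section (c : T -> R) (B : set T) : measurable B ->
  mu.-integrable setT (EFin \o c) ->
  mu.-integrable setT (EFin \o (fun x => c x * \1_B x)).
Proof.
move=> mB intc; have mc := measurable_int _ intc.
apply: le_integrable intc => //.
  by apply/measurable_EFinP; apply: measurable_funM => //; exact/measurable_EFinP.
move=> x _ /=; rewrite lee_fin normrM ler_piMr// indicE.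
by case: (x \in B); rewrite ?normr1 ?normr0.
Qed.

Lemma Rintegral_kernel_swap :
  \int[mu]_t (h t * \int[mu]_s (f s * \1_A (t, s))) =
  \int[mu]_s (f s * \int[mu]_t (h t * \1_A (t, s))).
Proof.
have sec1 t : mu.-integrable setT (EFin \o (fun s => f s * \1_A (t, s))).
  have -> : (fun s => f s * \1_A (t, s)) = (fun s => f s * \1_(xsection A t) s).
    by apply/funext => s; rewrite !indicE mem_xsection.
  by apply: integrable_section => //; exact: measurable_xsection.
have sec2 s : mu.-integrable setT (EFin \o (fun t => h t * \1_A (t, s))).
  have -> : (fun t => h t * \1_A (t, s)) = (fun t => h t * \1_(ysection A s) t).
    by apply/funext => t; rewrite !indicE mem_ysection.
  by apply: integrable_section => //; exact: measurable_ysection.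
rewrite /Rintegral; congr fine.
(* The inner integrals are finite, so the outer factors move inside them; what remains is Fubini for
   extended-real integrals. *)
transitivity (\int[mu]_t \int[mu]_s (h t * (f s * \1_A (t, s)))%:E)%E.
  apply: eq_integral => t _; rewrite EFinM fineK; last first.
    by apply: integrable_fin_num => //; exact: sec1.
  by rewrite -integralZl//; exact: sec1.
rewrite (Fubini integrable_kernel); apply: eq_integral => s _ /=.
rewrite EFinM fineK; last by apply: integrable_fin_num => //; exact: sec2.
by under eq_integral do rewrite mulrCA EFinM; rewrite integralZl//; exact: sec2.
Qed.

End product_kernel.

(** Fubini's theorem also yields measurability of section integrals; the outer factor is taken to be
    1, integrable because the measure is finite. *)
Lemma measurable_Rintegral_kernel d (T : measurableType d) (R : realType)
    (mu : {finite_measure set T -> \bar R}) (f : T -> R) (A : set (T * T)) :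
  measurable A -> mu.-integrable setT (EFin \o f) ->
  measurable_fun setT (fun t => \int[mu]_s (f s * \1_A (t, s))).
Proof.
move=> mA intf; apply: measurableT_comp => //.
have int1 : mu.-integrable setT (EFin \o cst 1).
  exact: finite_measure_integrable_cst.
have /measurable_fubini_F := integrable_kernel intf int1 mA.
by rewrite /fubini_F/=; under eq_fun do under eq_integral do rewrite mul1r.
Qed.

(** * Integrals over small sets, bounded factors, inclusions of intervals *)

Lemma Rintegral_small d (T : measurableType d) (R : realType)
    (mu : {measure set T -> \bar R}) (D : set T) (f : T -> R) (e : R) :
  measurable D -> mu.-integrable D (EFin \o f) -> 0 < e ->
  exists2 r, 0 < r & forall A, measurable A -> A `<=` D -> (mu A < r%:E)%E ->
    \int[mu]_(x in A) `|f x| < e.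
Proof.
move=> mD intf e0.
have intfD : mu.-integrable setT (EFin \o (f \_ D)).
  by rewrite -restrict_EFin; apply/(integrable_mkcond (EFin \o f) mD).
have [r [r0 fr]] := integral_normr_continuous intfD e0.
exists r => // A mA AD /(fr _ mA); apply: le_lt_trans.
rewrite le_eqVlt (_ : _ == _)//; apply/eqP; apply: eq_Rintegral => x /set_mem/AD Dx.
by rewrite patchE mem_set.
Qed.

Lemma integrable_bounded_mul d (T : measurableType d) (R : realType)
    (mu : {measure set T -> \bar R}) (D : set T) (f c : T -> R) (M : R) :
  measurable D -> mu.-integrable D (EFin \o f) -> measurable_fun D c ->
  (forall x, D x -> `|c x| <= M) ->
  mu.-integrable D (EFin \o (fun x => c x * f x)).
Proof.
move=> mD intf mc cM; refine (integrableMr mD mc _ intf).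
exists M; split => [|N MN x /cM cx]; first exact: num_real.
exact: le_trans cx (ltW MN).
Qed.

Lemma subset_itv_initial (R : realType) (a b t : R) : t <= b ->
  `[a, t[%classic `<=` `[a, b[%classic.
Proof. by move=> tb; apply: subset_itvl; rewrite bnd_simp. Qed.

Lemma subset_itv_final (R : realType) (a b t : R) : a <= t ->
  `]t, b[%classic `<=` `[a, b[%classic.
Proof. by move=> ta; apply: subset_itvr; rewrite bnd_simp. Qed.

(** * Primitives of integrable functions *)

Section primitive.
Variables (R : realType) (a b : R) (g : derivator a b).
Local Notation mu := (completed_stieltjes_measure g).
Local Notation T := (stieltjes_type g).
Local Notation I := (`[a, b[%classic : set T).

Let mI : measurable I. Proof. exact: measurable_itvT. Qed.

Let measurable_coord : measurable_fun [set: T] (fun x : T => x : measurableTypeR R).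
Proof. by move=> _ B mB; rewrite setTI; exact: borel_completed. Qed.

(** The identity from the completed to the Borel sigma-algebra is measurable, so the two coordinates
    are real measurable functions on the product and can be compared. *)
Lemma measurable_above_diagonal : measurable [set x : T * T | (x.2 < x.1 :> R)].
Proof.
have mlt : measurable_fun setT (fun x : T * T => (x.2 : R) < (x.1 : R)).
  apply: measurable_fun_ltr.
    exact: (measurableT_comp measurable_coord measurable_snd).
  exact: (measurableT_comp measurable_coord measurable_fst).
by have := mlt measurableT [set true] Logic.I; rewrite setTI.
Qed.

Let Lt := [set x : T * T | (x.2 < x.1 :> R)].
Let mLt : measurable Lt := measurable_above_diagonal.

Lemma integrable_patch f : mu.-integrable I (EFin \o f) ->
  mu.-integrable setT (EFin \o (f \_ I)).
Proof.
by move=> intf; rewrite -restrict_EFin; apply/(integrable_mkcond (EFin \o f) mI).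
Qed.

Lemma integrable_sub f (D : set T) : measurable D -> D `<=` I ->
  mu.-integrable I (EFin \o f) -> mu.-integrable D (EFin \o f).
Proof. by move=> mD DI; apply: integrableS. Qed.

(** Presents a primitive as a section integral over the half-plane s < t, the form to which Fubini's
    theorem and its measurability statement apply. *)
Lemma primitive_kernel f t : t <= b ->
  \int[mu]_(x in `[a, t[) f x = \int[mu]_s ((f \_ I) s * \1_Lt (t, s)).
Proof.
move=> tb; rewrite Rintegral_mkcond; apply: eq_Rintegral => s _.
rewrite !patchE indicE; case: ifPn => [|].
  rewrite inE/= in_itv/= => /andP[as_ st].
  rewrite !mem_set ?mulr1//=; first by rewrite in_itv/= as_ (lt_le_trans st).
move=> /negP; rewrite inE/= in_itv/= => /negP; rewrite negb_and => H.
case: ifPn; last by rewrite mul0r.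
rewrite inE/= in_itv/= => /andP[as_ sb]; move: H; rewrite as_/= => H.
by rewrite memNset ?mulr0//=; exact/negP.
Qed.

(** The other section of the same half-plane: s is fixed and t varies. *)
Lemma upper_kernel h s : s \in `[a, b[ ->
  \int[mu]_(x in `]s, b[) h x = \int[mu]_t ((h \_ I) t * \1_Lt (t, s)).
Proof.
rewrite in_itv/= => /andP[as_ sb]; rewrite Rintegral_mkcond; apply: eq_Rintegral => t _.
rewrite !patchE indicE; case: ifPn => [|].
  rewrite inE/= in_itv/= => /andP[st tb].
  by rewrite !mem_set ?mulr1//= in_itv/= tb (le_trans as_ (ltW st)).
move=> /negP; rewrite inE/= in_itv/= => /negP; rewrite negb_and => H.
case: ifPn; last by rewrite mul0r.
rewrite inE/= in_itv/= => /andP[at_ tb]; move: H; rewrite tb/= orbF => H.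
by rewrite memNset ?mulr0//=; exact/negP.
Qed.

Lemma measurable_primitive f : mu.-integrable I (EFin \o f) ->
  measurable_fun I (fun t => \int[mu]_(x in `[a, t[) f x).
Proof.
move=> /integrable_patch intf.
apply: (@eq_measurable_fun _ _ _ _ I (fun t => \int[mu]_s ((f \_ I) s * \1_Lt (t, s)))).
  move=> t; rewrite inE/= in_itv/= => /andP[_ /ltW tb].
  by rewrite -primitive_kernel.
by apply: measurable_funTS; exact: measurable_Rintegral_kernel.
Qed.

Lemma measurable_upper_primitive f : mu.-integrable I (EFin \o f) ->
  measurable_fun I (fun t => \int[mu]_(x in `]t, b[) f x).
Proof.
move=> /integrable_patch intf.
(* [measurable_Rintegral_kernel] integrates over the second coordinate, [upper_kernel] over the
   first; hence the exchange of coordinates. *)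
pose Gt := [set x : T * T | (x.1 < x.2 :> R)].
have mGt : measurable Gt.
  have -> : Gt = (fun x => (x.2, x.1)) @^-1` Lt by [].
  by rewrite -[X in measurable X]setTI; apply: measurable_swap.
apply: (@eq_measurable_fun _ _ _ _ I (fun t => \int[mu]_s ((f \_ I) s * \1_Gt (t, s)))).
  move=> t; rewrite inE/= => tI.
  by rewrite upper_kernel//; apply: eq_Rintegral => s _; rewrite !indicE.
by apply: measurable_funTS; exact: measurable_Rintegral_kernel.
Qed.

Lemma norm_Rintegral_sub f (D : set T) : measurable D -> D `<=` I ->
  mu.-integrable I (EFin \o f) ->
  `|\int[mu]_(x in D) f x| <= \int[mu]_(x in I) `|f x|.
Proof.
move=> mD DI intf; apply: le_trans (le_normr_Rintegral _ _) _ => //.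
  exact: integrable_sub intf.
have intnf : mu.-integrable I (EFin \o (fun x => `|f x|)).
  by have := integrable_abse intf.
rewrite /Rintegral fine_le//.
- by apply: integrable_fin_num => //; exact: integrable_sub intnf.
- by apply: integrable_fin_num.
- apply: (ge0_subset_integral _ mD mI (measurable_int _ intnf)) => // x _.
  by rewrite lee_fin.
Qed.

(** A primitive is measurable and bounded by the L^1 norm of [f], so multiplying by it preserves
    integrability. *)
Lemma integrable_primitive_mul f h : mu.-integrable I (EFin \o f) ->
  mu.-integrable I (EFin \o h) ->
  mu.-integrable I (EFin \o (fun t => \int[mu]_(x in `[a, t[) f x * h t)).
Proof.
move=> intf inth; apply: (integrable_bounded_mul mI inth (measurable_primitive intf)
  (M := \int[mu]_(x in I) `|f x|)).
move=> x /=; rewrite in_itv/= => /andP[_ /ltW xb]; apply: norm_Rintegral_sub => //.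
  exact: measurable_itvT.
exact: subset_itv_initial.
Qed.

Lemma integrable_upper_primitive_mul f h : mu.-integrable I (EFin \o f) ->
  mu.-integrable I (EFin \o h) ->
  mu.-integrable I (EFin \o (fun t => \int[mu]_(x in `]t, b[) f x * h t)).
Proof.
move=> intf inth; apply: (integrable_bounded_mul mI inth
  (measurable_upper_primitive intf) (M := \int[mu]_(x in I) `|f x|)).
move=> x /=; rewrite in_itv/= => /andP[ax _]; apply: norm_Rintegral_sub => //.
  exact: measurable_itvT.
exact: subset_itv_final.
Qed.

(** Both sides integrate f(s) h(t) over the strict triangle s < t, the left one over s first, the
    right one over t first. *)
Lemma Rintegral_primitive_upper f h : mu.-integrable I (EFin \o f) ->
  mu.-integrable I (EFin \o h) ->
  \int[mu]_(t in I) (\int[mu]_(x in `[a, t[) f x * h t) =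
  \int[mu]_(t in I) (\int[mu]_(x in `]t, b[) h x * f t).
Proof.
move=> intf inth; rewrite [LHS]Rintegral_mkcond [RHS]Rintegral_mkcond.
transitivity (\int[mu]_t ((h \_ I) t * \int[mu]_s ((f \_ I) s * \1_Lt (t, s)))).
  apply: eq_Rintegral => t _; rewrite !patchE.
  case: ifPn => [|_]; last by rewrite mul0r.
  by rewrite inE/= in_itv/= => /andP[_ /ltW tb]; rewrite -primitive_kernel// [LHS]mulrC.
rewrite Rintegral_kernel_swap//; [|exact: integrable_patch..].
apply: eq_Rintegral => t _; rewrite !patchE.
case: ifPn => [|_]; last by rewrite mul0r.
by rewrite inE/= => tI; rewrite -upper_kernel// [LHS]mulrC.
Qed.

(** With interval bounds instead of points, the cut can pass to the left or to the right of a point,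
    which matters when the point carries an atom. *)
Lemma Rintegral_itv_split (x y z : itv_bound R) h : (x <= y)%O -> (y <= z)%O ->
  mu.-integrable [set` Interval x z] (EFin \o h) ->
  \int[mu]_(r in [set` Interval x z]) h r =
  \int[mu]_(r in [set` Interval x y]) h r + \int[mu]_(r in [set` Interval y z]) h r.
Proof.
move=> xy yz; rewrite (itv_bndbnd_setU xy yz) => inth.
rewrite Rintegral_setU//; [exact: measurable_itvT..|].
apply/disj_setPS => r/= []; rewrite !itv_boundlr => /andP[_ ry] /andP[yr _].
by have := le_trans ry yr; rewrite bnd_simp ltxx.
Qed.

Lemma Rintegral_split_upper h t : mu.-integrable I (EFin \o h) -> t \in `[a, b[ ->
  \int[mu]_(x in I) h x = \int[mu]_(x in `[a, t]) h x + \int[mu]_(x in `]t, b[) h x.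
Proof.
move=> inth; rewrite in_itv/= => /andP[at_ tb].
by apply: Rintegral_itv_split => //; rewrite bnd_simp.
Qed.

End primitive.

Lemma subset_itv_endpoints (R : realType) (a b s t : R) : s < t ->
  `[s, t[%classic `<=` `[a, b[%classic -> a <= s /\ t <= b.
Proof.
move=> st sub; split.
  by have := sub s; rewrite /= !in_itv/= lexx st => /(_ isT)/andP[].
rewrite leNgt; apply/negP => bt.
(* If b < t, the point max(s, b) lies in [s, t) but not in [a, b). *)
have := sub (Num.max s b); rewrite /= !in_itv/= le_max lexx/= gt_max st bt.
by move=> /(_ isT)/andP[_]; rewrite gt_max ltxx andbF.
Qed.

(** * One-sided limits, atoms and absolute continuity *)

Section pointwise.
Variables (R : realType) (a b : R) (g : derivator a b).
Local Notation mu := (completed_stieltjes_measure g).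
Local Notation T := (stieltjes_type g).
Local Notation J := (`[a, b[%classic : set T).

Let mJ : measurable J. Proof. exact: measurable_itvT. Qed.

(** The intervals ]t, t + 1/(n+1)[ leave out the possible atom at t and decrease to the empty set;
    continuity from above applies because the mass is finite. *)
Lemma measure_right_small (t e : R) : 0 < e ->
  exists2 s, t < s & (mu `]t, s[%classic < e%:E)%E.
Proof.
move=> e0; pose F n : set T := `]t, t + n.+1%:R^-1[%classic.
have mF n : measurable (F n) by exact: measurable_itvT.
have niF : nonincreasing_seq F.
  move=> m n mn; apply/subsetPset => x; rewrite /F/= !in_itv/= => /andP[->/=].
  by move/lt_le_trans; apply; rewrite lerD2l lef_pV2 ?posrE// ler_nat.
have F0 : \bigcap_n F n = set0.
  apply/seteqP; split => // x Fx.
  have tx : 0 < x - t.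
    by have := Fx 0%N Logic.I; rewrite /F/= in_itv/= subr_gt0 => /andP[].
  have [n nx] : exists n, n.+1%:R^-1 < x - t.
    exists (Num.truncn (x - t)^-1); rewrite invf_plt ?posrE//; exact: truncnS_gt.
  have := Fx n Logic.I; rewrite /F/= in_itv/= => /andP[_]; rewrite -ltrBlDl => xn.
  by have := lt_trans xn nx; rewrite ltxx.
have Foo : (mu (F 0%N) < +oo)%E by rewrite ltey_eq fin_num_measure.
have := nonincreasing_cvg_mu (mu := mu) Foo mF (bigcapT_measurable mF) niF.
rewrite F0 measure0.
move=> /fine_cvgP[_ /cvgrPdist_lt/(_ _ e0)[N _ /(_ N (leqnn _))]].
rewrite /= sub0r normrN => FN; exists (t + N.+1%:R^-1); first by rewrite ltrDl.
rewrite -[X in (X < _)%E]fineK; last exact: (fin_num_measure mu _ (mF N)).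
by rewrite lte_fin; exact: le_lt_trans (ler_norm _) FN.
Qed.

(** The difference is the integral over ]t, x[, whose mass tends to 0 as x decreases to t. An atom
    at t stays inside [a, t], so the closed integral is the right limit. *)
Lemma primitive_right_limit (f : R -> R) (t e : R) :
  mu.-integrable J (EFin \o f) -> t \in `[a, b[ -> 0 < e ->
  exists2 s, t < s <= b & forall x, t < x < s ->
    `|\int[mu]_(r in `[a, x[) f r - \int[mu]_(r in `[a, t]) f r| < e.
Proof.
move=> intf; rewrite in_itv/= => /andP[at_ tb] e0.
have [d d0 fd] := Rintegral_small mJ intf e0.
have [s ts sd] := measure_right_small t d0.
exists (Num.min s b); first by rewrite lt_min ts tb ge_min lexx orbT.
move=> x /andP[tx]; rewrite lt_min => /andP[xs xb].
rewrite (@Rintegral_itv_split _ _ _ g _ (BRight t)) ?bnd_simp//; last first.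
  apply: integrable_sub intf; first exact: measurable_itvT.
  by apply: subset_itv_initial; exact: ltW.
have sub : `]t, x[%classic `<=` J.
  by apply: subset_itv; rewrite bnd_simp// ltW.
rewrite addrAC subrr add0r (le_lt_trans (le_normr_Rintegral _ _))//.
- exact: measurable_itvT.
- by apply: integrable_sub intf => //; exact: measurable_itvT.
- apply: fd => //; first exact: measurable_itvT.
  apply: le_lt_trans sd; apply: le_measure; rewrite ?inE; [exact: measurable_itvT..|].
  by apply: subset_itv; rewrite bnd_simp// ltW.
Qed.

Lemma derivator_le s t : a <= s -> s <= t -> t <= b -> g s <= g t.
Proof.
move=> as_ st tb; apply: derivator_nd => //; rewrite in_itv/=.
  by rewrite as_ (le_trans st).
by rewrite tb (le_trans as_).
Qed.

(** [jumps_g] is phrased with [lim], which is informative only once the limit exists; monotonicity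
    provides it. *)
Lemma derivator_right_cvg t : t \in `[a, b[ -> cvg (g x @[x --> t^'+]).
Proof.
rewrite in_itv/= => /andP[at_ tb]; apply: nondecreasing_at_right_is_cvgr.
  near=> x => y z; rewrite !in_itv/= => /andP[ty yx] /andP[tz zx] yz.
  apply: derivator_le => //; first by rewrite (le_trans at_)// ltW.
  by apply: ltW; apply: lt_trans zx _; near: x; exact: nbhs_right_lt.
near=> x; exists (g t) => _ [y/= + <-]; rewrite in_itv/= => /andP[ty yx].
apply: derivator_le => //; first exact: ltW.
by apply: ltW; apply: lt_trans yx _; near: x; exact: nbhs_right_lt.
Unshelve. all: by end_near. Qed.

(** For t < x < b the mass of {t} is at most that of [t, x), which is g x - g t. Let x decrease to
    t, where the right limit of g is at most g t. *)
Lemma measure_set1_continuity_point t : t \in `[a, b[ -> ~ jumps_g g t ->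
  mu [set t] = 0%E.
Proof.
move=> tab /not_andP[//|/negP]; rewrite -leNgt subr_le0 => gt.
move: (tab); rewrite in_itv/= => /andP[at_ tb].
have m1 : measurable ([set t] : set T).
  by apply: borel_completed; exact: measurable_set1.
apply/eqP; rewrite -measure_le0 -[leLHS]fineK; last exact: (fin_num_measure mu _ m1).
suff : fine (mu [set t]) + g t <= lim (g x @[x --> t^'+]).
  by move=> h; rewrite lee_fin; have := le_trans h gt; lra.
apply: limr_ge; first exact: derivator_right_cvg.
near=> x.
have tx : t < x by near: x; exact: nbhs_right_gt.
have xb : x < b by near: x; exact: nbhs_right_lt.
rewrite -lerBrDr -lee_fin fineK; last exact: (fin_num_measure mu _ m1).
rewrite -completed_measure_itv ?in_itv/= ?(ltW tx) ?at_ ?(ltW xb) ?(ltW tb)//;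
  last first.
  by rewrite (le_trans at_)// ltW.
apply: le_measure; rewrite ?inE//; first exact: measurable_itvT.
by move=> _ ->; rewrite /= in_itv/= lexx.
Unshelve. all: by end_near. Qed.

Lemma primitive_continuity_point (f : R -> R) t :
  mu.-integrable J (EFin \o f) -> t \in `[a, b[ -> ~ jumps_g g t ->
  \int[mu]_(x in `[a, t]) f x = \int[mu]_(x in `[a, t[) f x.
Proof.
move=> intf tab tJ; have t0 := measure_set1_continuity_point tab tJ.
move: (tab); rewrite in_itv/= => /andP[at_ tb].
have m1 : measurable ([set t] : set T).
  by apply: borel_completed; exact: measurable_set1.
rewrite (@Rintegral_itv_split _ _ _ g _ (BLeft t)) ?bnd_simp//; last first.
  apply: integrable_sub intf; first exact: measurable_itvT.
  by apply: subset_itv; rewrite bnd_simp.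
have sub : [set t] `<=` J by move=> _ ->.
have mf := measurable_funS mJ sub (measurable_int _ intf).
by rewrite set_itv1 /Rintegral (null_set_integral m1 mf t0) addr0.
Qed.

(** The integrals over the disjoint intervals add up to one over their union, whose mass is the sum
    of the increments of g; absolute continuity of the integral concludes. *)
Lemma AC_primitive_norm (f : R -> R) (e : R) :
  mu.-integrable J (EFin \o f) -> 0 < e ->
  exists2 d, 0 < d & forall (n : nat) (s t : 'I_n -> R),
      (forall j, s j < t j) ->
      (forall j, `[s j, t j[ `<=` `[a, b[) ->
      trivIset setT (fun j => `[s j, t j[%classic) ->
      \sum_(j < n) (g (t j) - g (s j)) < d ->
      \sum_(j < n) \int[mu]_(x in `[s j, t j[) `|f x| < e.
Proof.
move=> intf e0; have [d d0 fd] := Rintegral_small mJ intf e0.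
exists d => // n s t st stab tst sum_d.
pose F (j : 'I_n) : set T := `[s j, t j[%classic.
have mF j : measurable (F j) by exact: measurable_itvT.
pose D := \big[setU/set0]_(j < n) F j.
have mD : measurable D by apply: bigsetU_measurable.
have DJ : D `<=` J by rewrite /D -bigcup_seq => x [j _]; exact: stab.
have intnf : mu.-integrable J (EFin \o (fun x => `|f x|)).
  by have := integrable_abse intf.
have -> : \sum_(j < n) \int[mu]_(x in `[s j, t j[) `|f x| =
    \int[mu]_(x in D) `|f x|.
  apply/EFin_inj; rewrite -sumEFin /Rintegral fineK; last first.
    exact: (integrable_fin_num mD (integrable_sub mD DJ intnf)).
  have tF : trivIset [set` index_enum 'I_n] F by exact: sub_trivIset tst.
  have mf := measurable_funS mJ DJ (measurable_int _ intnf).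
  rewrite /D (ge0_integral_bigsetU mu mF (index_enum_uniq _) tF mf); last first.
    by move=> x _; rewrite lee_fin.
  apply: eq_bigr => j _; rewrite fineK//.
  exact: (integrable_fin_num (mF j) (integrable_sub (mF j) (stab j) intnf)).
apply: fd => //; rewrite /D measure_bigsetU_ord//.
rewrite (eq_bigr (fun j => (g (t j) - g (s j))%:E)) ?sumEFin ?lte_fin// => j _.
have [as_ tb] := subset_itv_endpoints (st j) (stab j).
rewrite -completed_measure_itv ?in_itv/= ?as_ ?tb ?andbT//=.
- exact: le_trans (ltW (st j)) tb.
- exact: le_trans as_ (ltW (st j)).
- exact: ltW.
Qed.
End pointwise.

(** * Functions with vanishing primitive *)

Section vanishing_primitive.
Variables (R : realType) (a b : R) (g : derivator a b).
Local Notation mu := (completed_stieltjes_measure g).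
Local Notation T := (stieltjes_type g).
Local Notation J := (`[a, b[%classic : set T).

Let mJ : measurable J. Proof. exact: measurable_itvT. Qed.

Variable h : R -> R.
Hypothesis inth : mu.-integrable J (EFin \o h).
Hypothesis h0 : forall t, t \in `[a, b] -> \int[mu]_(x in `[a, t[) h x = 0.

Let h0e t : t \in `[a, b] -> (\int[mu]_(x in `[a, t[) (h x)%:E = 0)%E.
Proof.
move=> tab; have := h0 tab; rewrite /Rintegral => ht0.
rewrite -[LHS]fineK ?ht0//; apply: integrable_fin_num; first exact: measurable_itvT.
apply: integrable_sub inth; first exact: measurable_itvT.
by apply: subset_itv_initial; move: tab; rewrite in_itv/= => /andP[].
Qed.

(** Dynkin's pi-lambda theorem: the rays ]-oo, x[ are stable under intersection and generate the
    Borel sets. Complements are allowed because the integral over [a, b) is itself 0. *)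
Let borel_integral0 (B : set R) : measurable (B : set (measurableTypeR R)) ->
  (\int[mu]_(x in B `&` `[a, b[) (h x)%:E = 0)%E.
Proof.
have ab := derivator_lt g.
have intS (S : set R) : measurable (S : set (measurableTypeR R)) ->
    measurable (S `&` `[a, b[ : set T) /\
    mu.-integrable (S `&` `[a, b[) (EFin \o h).
  move=> /borel_completed mS; have mSJ : measurable (S `&` J : set T).
    exact: measurableI.
  by split => //; exact: (integrable_sub mSJ (@subIsetr _ _ _) inth).
have intT : (\int[mu]_(x in `[a, b[) (h x)%:E = 0)%E.
  by apply: h0e; rewrite in_itv/= lexx ltW.
have GE : @measurable _ (measurableTypeR R) = <<s @RGenInftyO.G R >>.
  exact: RGenInftyO.measurableE.
rewrite GE; move: B.
apply: (@dynkin_induction _ (measurableTypeR R) _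
  (fun B => \int[mu]_(x in B `&` `[a, b[) (h x)%:E = 0)%E GE).
- move=> _ _ [x ->] [y ->]; exists (Num.min x y).
  apply/seteqP; split => z/=; rewrite !in_itv/= lt_min; first by case=> -> ->.
  by move=> /andP[].
- by rewrite setTI.
- move=> _ [x ->].
  have -> : (`]-oo, x[ `&` `[a, b[ = `[a, clamp a b x[)%classic.
    apply/seteqP; split => z/=; rewrite !in_itv/= /clamp lt_max lt_min.
      by move=> [-> /andP[-> ->]]; rewrite orbT.
    by move=> /andP[az]; rewrite ltNge az /= => /andP[-> ->].
  by apply: h0e; exact: clamp_itv g x.
- move=> S mS S0; have [mSJ iS] := intS _ mS.
  have [mCJ iC] := intS _ (measurableC mS).
  have E : (S `&` `[a, b[) `|` (~` S `&` `[a, b[) = (`[a, b[%classic : set T).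
    by rewrite -setIUl setUv setTI.
  have mU : measurable_fun ((S `&` `[a, b[) `|` (~` S `&` `[a, b[) : set T) (EFin \o h).
    by rewrite E; exact: measurable_int inth.
  have dis : [disjoint (S `&` `[a, b[) & (~` S `&` `[a, b[)].
    by apply/disj_setPS => x [[? _] [? _]].
  by have := integral_setU mu mSJ mCJ mU dis; rewrite E intT S0 add0e => <-.
- move=> F mF tF F0; rewrite setI_bigcupl integral_bigcup.
  + by rewrite eseries0// => i _ _; exact: F0.
  + by apply: trivIset_setIr.
  + by move=> k; have [] := intS _ (mF k).
  + rewrite -setI_bigcupl.
    by have [] := intS _ (bigcupT_measurable F mF).
Qed.

(** The completed measure of [E] is an infimum over countable covers by Borel sets; [B] is the union
    of a nearly optimal cover. *)
Let cover_integral (E : set T) (r : R) : measurable E -> 0 < r ->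
  exists B : set R, [/\ measurable (B : set (measurableTypeR R)), E `<=` B &
    (mu (B `\` E) < r%:E)%E].
Proof.
move=> mE r0; have Efin : mu E \is a fin_num by exact: fin_num_measure.
have [_ [A [mA EA] <-] Ar] := lb_ereal_inf_adherent r0 Efin.
have mB : measurable (\bigcup_k A k : set (measurableTypeR R)).
  exact: bigcupT_measurable.
exists (\bigcup_k A k); split => //.
rewrite measureD//; [|exact: borel_completed|].
  rewrite setIidr// lteBlDl//.
  apply: le_lt_trans Ar.
  rewrite [leLHS](completed_stieltjes_measure_borel g mB).
  exact: measure_sigma_subadditive.
by rewrite ltey_eq fin_num_measure//; exact: borel_completed.
Qed.

(** It is enough that the integrals of [h] over all measurable sets vanish. A set [E] of the
    completion is enclosed in a Borel set [B] with little excess mass: the integral over [B] is 0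
    and the one over the excess is small. *)
Lemma vanishing_primitive_ae0 : {ae mu, forall t, t \in `[a, b[ -> h t = 0}.
Proof.
have := @integral_ae_eq _ T R mu J mJ (cst 0%E) (EFin \o h) inth (measurable_cst _).
move=> H; have /H : forall E : set T, E `<=` J -> measurable E ->
    (\int[mu]_(x in E) (EFin \o h) x = \int[mu]_(x in E) cst 0 x)%E.
  move=> E EJ mE; rewrite integral0.
  have intE := integrable_sub mE EJ inth.
  apply/eqP; rewrite -abse_eq0 eq_le abse_ge0 andbT -(EFin_normr_Rintegral mE intE).
  rewrite lee_fin; apply/ler_addgt0Pr => e e0; rewrite add0r.
  have [r r0 hr] := Rintegral_small mJ inth e0.
  have [B [mB EB Br]] := cover_integral mE r0.
  have mBJ : measurable (B `&` J : set T).
    by apply: measurableI => //; exact: borel_completed.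
  have mD : measurable (B `&` J `\` E : set T) by exact: measurableD.
  have DJ : B `&` J `\` E `<=` J by move=> x [[]].
  have EU : E `|` (B `&` J `\` E) = B `&` J.
    by rewrite setDUK//; move=> x Ex; split; [exact: EB|exact: EJ].
  have : \int[mu]_(x in B `&` J) h x = 0 by rewrite /Rintegral borel_integral0.
  rewrite -EU Rintegral_setU//; last 2 first.
  - by rewrite EU; exact: (integrable_sub mBJ (@subIsetr _ _ _) inth).
  - by apply/disj_setPS => x [? []].
  move/eqP; rewrite addr_eq0 => /eqP ->; rewrite normrN.
  apply: le_trans (le_normr_Rintegral mD (integrable_sub mD DJ inth)) _.
  apply/ltW/hr => //; apply: le_lt_trans Br; apply: le_measure; rewrite ?inE//.
    by apply: measurableD => //; exact: borel_completed.
  by move=> x [[]].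
by apply: filterS => x /= hx xab; have := hx xab => -[].
Qed.

End vanishing_primitive.

(** Suppose [P] fails at every such s, and let r be the supremum of the points of [t, b] where g
    exceeds g t by less than d. Then [t, r) is null, so g r = g t and r < b; {r} is null as well;
    hence just to the right of r the increase of g is still below d, against the choice of r. *)
Lemma ae_near_right (R : realType) (a b : R) (g : derivator a b) (P : R -> Prop)
    (t d : R) :
  {ae completed_stieltjes_measure g, forall s, s \in `[a, b[ -> P s} ->
  t \in `[a, b[ -> g t < g b -> 0 < d ->
  exists s, [/\ t <= s, s < b, g s - g t < d & P s].
Proof.
move=> aeP; rewrite in_itv/= => /andP[at_ tb] gtb d0.
pose mu := completed_stieltjes_measure g.
apply: contrapT => noP.
(* The null set where [P] fails contains all points of [t, b) at which g exceeds g t by less than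
   d. *)
have negl (E : set (stieltjes_type g)) : measurable E -> E `<=` `[t, b[ ->
    (forall s, E s -> g s - g t < d) -> mu E = 0%E.
  move=> mE Etb Ed; apply/(negligibleP _ mE); apply: negligibleS aeP => s Es /=.
  move=> Ps; apply: noP; exists s.
  have := Etb s Es; rewrite /= in_itv/= => /andP[ts sb]; split => //; first exact: Ed.
  by apply: Ps; rewrite in_itv/= sb (le_trans at_).
pose r := sup [set s | t <= s <= b /\ g s - g t < d].
have tA : [set s | t <= s <= b /\ g s - g t < d] t.
  by rewrite /= lexx (ltW tb) subrr.
have ubA : ubound [set s | t <= s <= b /\ g s - g t < d] b.
  by move=> x [/andP[]].
have supA : has_sup [set s | t <= s <= b /\ g s - g t < d].
  by split; [exists t|exists b].
have tr : t <= r by exact: ub_le_sup (supA.2) _ tA.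
have rb : r <= b by apply: ge_sup => //; exists t.
have below s : t <= s -> s < r -> g s - g t < d.
  move=> ts sr; have [x [/andP[tx xb] gx] sx] := sup_gt supA.1 sr.
  apply: le_lt_trans gx; rewrite lerD2r; apply: derivator_le => //.
  - exact: le_trans ts.
  - exact: ltW.
have above s : r < s -> s <= b -> d <= g s - g t.
  move=> rs sb; rewrite leNgt; apply/negP => gs.
  have : s <= r.
    by apply: ub_le_sup (supA.2) _ _; rewrite /= sb andbT (le_trans tr (ltW rs)).
  by rewrite leNgt rs.
have gr : g r = g t.
  have : mu `[t, r[%classic = 0%E.
    apply: negl; first exact: measurable_itvT.
      by apply: subset_itvl; rewrite bnd_simp.
    by move=> s; rewrite /= in_itv/= => /andP[]; exact: below.
  rewrite /mu completed_measure_itv ?in_itv/= ?at_ ?(ltW tb) ?rb ?andbT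
    ?(le_trans at_)//.
  by move=> [/eqP]; rewrite subr_eq0 => /eqP.
move: rb; rewrite le_eqVlt => /predU1P[rb|rb].
  by move: gtb; rewrite -[X in _ < g X]rb gr ltxx.
have [s rs sd] := measure_right_small g r d0.
pose x := Num.min s b.
have rx : r < x by rewrite lt_min rs rb.
have xb : x <= b by rewrite ge_min lexx orbT.
have := above x rx xb; apply/negP; rewrite -ltNge -gr -lte_fin.
rewrite -completed_measure_itv ?in_itv/= ?xb ?(ltW rb) ?andbT ?(ltW rx)//; last 2 first.
- by rewrite (le_trans at_).
- by rewrite (le_trans at_)// (le_trans tr)// ltW.
have -> : `[r, x[%classic = ([set r] : set R) `|` `]r, x[%classic.
  by rewrite setU1itv ?bnd_simp.
have m1 : measurable ([set r] : set (stieltjes_type g)).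
  by apply: borel_completed; exact: measurable_set1.
rewrite measureU//; last 2 first.
- exact: measurable_itvT.
- by apply/seteqP; split => // y [-> /=]; rewrite in_itv/= ltxx.
(* Since g r = g t, the point r is itself exceptional, so it carries no atom. *)
rewrite [X in (X + _)%E](_ : _ = 0%E) ?add0e; last first.
  apply: negl => //; first by move=> _ ->; rewrite /= in_itv/= tr rb.
  by move=> _ ->; rewrite gr subrr.
apply: le_lt_trans sd; apply: le_measure; rewrite ?inE; [exact: measurable_itvT..|].
by apply: subset_itvl; rewrite bnd_simp ge_min lexx.
Qed.

Lemma modulusE (R : realType) (k : scalar_kind) (z : scalar_field R k) :
  modulus z = Num.sqrt (scalar_re z ^+ 2 + scalar_im z ^+ 2).
Proof.
rewrite /modulus; case: k z => [z|[x y]]; last by rewrite normc_def.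
by rewrite /= expr0n addr0 sqrtr_sqr.
Qed.

(** * Scalar-valued functions *)

Section scalar_spaces.
Variables (R : realType) (k : scalar_kind) (a b : R) (g : derivator a b).
Local Notation K := (scalar_field R k).
Local Notation mu := (completed_stieltjes_measure g).
Local Notation T := (stieltjes_type g).
Local Notation J := (`[a, b[%classic : set T).

Let mJ : measurable J. Proof. exact: measurable_itvT. Qed.

Definition scalar_integrable (f : R -> K) : Prop :=
  mu.-integrable J (EFin \o (fun t => scalar_re (f t))) /\
  mu.-integrable J (EFin \o (fun t => scalar_im (f t))).

Lemma scalar_re_integral_g (D : set R) (f : R -> K) :
  scalar_re (integral_g g D f) = \int[mu]_(t in D) scalar_re (f t).
Proof. exact: scalar_re_mk. Qed.

(** For real scalars [mk_scalar] drops its second argument, and the right-hand side is the integral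
    of 0. *)
Lemma scalar_im_integral_g (D : set R) (f : R -> K) :
  scalar_im (integral_g g D f) = \int[mu]_(t in D) scalar_im (f t).
Proof. by case: k f => f //; rewrite /= /Rintegral integral0. Qed.

Lemma integral_g_set0 (f : R -> K) : integral_g g set0 f = 0.
Proof.
apply: scalar_eq; rewrite ?scalar_re_integral_g ?scalar_im_integral_g Rintegral_set0.
  by case: k.
by case: k.
Qed.

Lemma measurable_modulus (f : R -> K) :
  measurable_fun J (fun t => scalar_re (f t)) ->
  measurable_fun J (fun t => scalar_im (f t)) ->
  measurable_fun J (fun t => modulus (f t)).
Proof.
move=> mre mim.
have -> : (fun t => modulus (f t)) =
    Num.sqrt \o (fun t => scalar_re (f t) ^+ 2 + scalar_im (f t) ^+ 2).
  by apply/funext => t; exact: modulusE.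
apply: (measurableT_comp (continuous_measurable_fun (@sqrt_continuous R))).
by apply: measurable_funD; apply: measurable_funX.
Qed.

Lemma Lp_g_Lfun p (f : R -> K) : Lp_g g p f ->
  (fun t => modulus (f t)) \_ J \in Lfun mu p.
Proof.
move=> [mre mim fp]; apply/andP; split; rewrite inE; last exact: fp.
by apply/(measurable_restrictT _ mJ); exact: measurable_modulus.
Qed.

(** The measure is finite, so the L^p spaces decrease in p. *)
Lemma Lp_g_sub p q (f : R -> K) : (1 <= p)%E -> (p <= q)%E -> Lp_g g q f -> Lp_g g p f.
Proof.
move=> p1 pq [mre mim fq]; split => //.
have Tfin : mu [set: T] \is a fin_num by exact: fin_num_measure.
have := Lfun_subset p1 (le_trans p1 pq) Tfin pq (Lp_g_Lfun (And3 mre mim fq)).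
by case/andP; rewrite !inE.
Qed.

Lemma Lp_g_integrable p (f : R -> K) : (1 <= p)%E -> Lp_g g p f -> scalar_integrable f.
Proof.
move=> p1 /(Lp_g_sub (lexx _) p1) fL1.
have [mre mim _] := fL1.
have int : mu.-integrable J (EFin \o (fun t => modulus (f t))).
  have /Lfun1_integrable := Lp_g_Lfun fL1.
  rewrite -restrict_EFin.
  by move=> /(integrable_mkcond (EFin \o (fun t : T => modulus (f t))) mJ).
split; apply: (le_integrable mJ _ _ int) => [|x _]; rewrite ?lee_fin.
- exact/measurable_EFinP.
- by rewrite /= (le_trans (norm_scalar_le_modulus _).1)// ler_norm.
- exact/measurable_EFinP.
- by rewrite /= (le_trans (norm_scalar_le_modulus _).2)// ler_norm.
Qed.

(** A bounded function is in L^oo, hence in every L^p; this places primitives and indicators in the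
    spaces for all exponents at once. *)
Lemma bounded_Lp_g p (f : R -> K) (M : R) : (1 <= p)%E ->
  measurable_fun J (fun t => scalar_re (f t)) ->
  measurable_fun J (fun t => scalar_im (f t)) ->
  (forall t, t \in `[a, b[ -> modulus (f t) <= M) -> Lp_g g p f.
Proof.
move=> p1 mre mim fM; apply: (Lp_g_sub p1 (leey _)); split => //.
rewrite /finite_norm unlock /Lnorm; case: ifPn => // _.
(* The function is extended by 0 outside [a, b), so the bound must also be at least 0. *)
apply: (@le_lt_trans _ _ (Num.max M 0)%:E); last exact: ltry.
apply/ess_supP/nearW => t /=; rewrite lee_fin patchE.
case: ifPn => [|_]; last by rewrite normr0 le_max lexx orbT.
rewrite inE/= => /fM ftM.
by rewrite ger0_norm ?modulus_ge0// le_max ftM.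
Qed.

Lemma is_stieltjes_deriv_integrable (U w : R -> K) :
  is_stieltjes_deriv g U w -> scalar_integrable w.
Proof. by move=> [w1 _]; apply: Lp_g_integrable w1. Qed.

Lemma is_stieltjes_deriv_re (U w : R -> K) t : is_stieltjes_deriv g U w ->
  t \in `[a, b] ->
  scalar_re (U t) = scalar_re (U a) + \int[mu]_(x in `[a, t[) scalar_re (w x).
Proof. by move=> [_ /[apply] ->]; rewrite scalar_reD scalar_re_integral_g. Qed.

Lemma is_stieltjes_deriv_im (U w : R -> K) t : is_stieltjes_deriv g U w ->
  t \in `[a, b] ->
  scalar_im (U t) = scalar_im (U a) + \int[mu]_(x in `[a, t[) scalar_im (w x).
Proof. by move=> [_ /[apply] ->]; rewrite scalar_imD scalar_im_integral_g. Qed.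

(** At a jump the trace is a right limit, given by [primitive_right_limit]; elsewhere {t} is null,
    and the integrals over [a, t[ and [a, t] agree. *)
Lemma posterior_trace_primitive (U w : R -> K) t : is_stieltjes_deriv g U w ->
  t \in `[a, b[ -> posterior_trace g U t = U a + integral_g g `[a, t] w.
Proof.
move=> dU tab; have [intre intim] := is_stieltjes_deriv_integrable dU.
have tab' : t \in `[a, b].
  by move: tab; rewrite !in_itv/= => /andP[-> /ltW].
rewrite /posterior_trace; case: ifPn => [_|].
  apply: cvg_lim; first exact: norm_hausdorff.
  apply: modulus_cvg => e e0; have e20 : 0 < e / 2 by rewrite divr_gt0.
  have [s1 /andP[ts1 s1b] re1] := primitive_right_limit intre tab e20.
  have [s2 /andP[ts2 s2b] im2] := primitive_right_limit intim tab e20.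
  near=> x.
  have tx : t < x by near: x; exact: nbhs_right_gt.
  have xs1 : x < s1 by near: x; exact: nbhs_right_lt.
  have xs2 : x < s2 by near: x; exact: nbhs_right_lt.
  have xab : x \in `[a, b].
    move: tab; rewrite !in_itv/= => /andP[at_ _].
    by rewrite (le_trans at_ (ltW tx)) (le_trans (ltW xs1)).
  apply: le_lt_trans (modulus_le _) _; rewrite (splitr e); apply: ltrD.
    rewrite scalar_reD scalar_reN scalar_reD (is_stieltjes_deriv_re dU xab).
    rewrite scalar_re_integral_g opprD addrACA subrr add0r.
    by apply: re1; rewrite tx xs1.
  rewrite scalar_imD scalar_imN scalar_imD (is_stieltjes_deriv_im dU xab).
  rewrite scalar_im_integral_g opprD addrACA subrr add0r.
  by apply: im2; rewrite tx xs2.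
move=> /negP; rewrite inE => tJ.
apply: scalar_eq;
  rewrite ?scalar_reD ?scalar_imD ?scalar_re_integral_g ?scalar_im_integral_g.
  by rewrite primitive_continuity_point//; exact: is_stieltjes_deriv_re.
by rewrite primitive_continuity_point//; exact: is_stieltjes_deriv_im.
Unshelve. all: by end_near. Qed.

(** An increment of [U] is the integral of [w] over [s_j, t_j), so [AC_primitive_norm] keeps the
    sums for the real and for the imaginary parts below e/2 each. *)
Lemma is_stieltjes_deriv_AC (U w : R -> K) : is_stieltjes_deriv g U w -> AC_g g U.
Proof.
move=> dU e e0; have [intre intim] := is_stieltjes_deriv_integrable dU.
have e20 : 0 < e / 2 by rewrite divr_gt0.
have [d1 d10 re1] := AC_primitive_norm intre e20.
have [d2 d20 im2] := AC_primitive_norm intim e20.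
exists (Num.min d1 d2); first by rewrite lt_min d10.
move=> n s t st stab tst; rewrite lt_min => /andP[/(re1 _ _ _ st stab tst) sre].
move=> /(im2 _ _ _ st stab tst) sim.
rewrite (splitr e); apply: le_lt_trans (ltrD sre sim).
rewrite -big_split/=; apply: ler_sum => j _.
have [as_ tb] := subset_itv_endpoints (st j) (stab j).
have sab : s j \in `[a, b] by rewrite in_itv/= as_ (le_trans (ltW (st j))).
have tab : t j \in `[a, b] by rewrite in_itv/= tb (le_trans as_ (ltW (st j))).
have mst : measurable (`[s j, t j[%classic : set T) by exact: measurable_itvT.
have split_prim (f : R -> R) : mu.-integrable J (EFin \o f) ->
    \int[mu]_(x in `[a, t j[) f x =
    \int[mu]_(x in `[a, s j[) f x + \int[mu]_(x in `[s j, t j[) f x.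
  move=> intf; apply: Rintegral_itv_split; rewrite ?bnd_simp//; first exact: ltW.
  apply: integrable_sub intf; first exact: measurable_itvT.
  exact: subset_itv_initial.
apply: le_trans (modulus_le _) _; apply: lerD.
  rewrite scalar_reD scalar_reN.
  rewrite (is_stieltjes_deriv_re dU tab) (is_stieltjes_deriv_re dU sab).
  rewrite split_prim//.
  rewrite [X in `|X|](_ : _ = \int[mu]_(x in `[s j, t j[) scalar_re (w x)); last first.
    by ring.
  by apply: le_normr_Rintegral => //; exact: integrable_sub mst (stab j) intre.
rewrite scalar_imD scalar_imN.
rewrite (is_stieltjes_deriv_im dU tab) (is_stieltjes_deriv_im dU sab).
rewrite split_prim//.
rewrite [X in `|X|](_ : _ = \int[mu]_(x in `[s j, t j[) scalar_im (w x)); last first.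
  by ring.
by apply: le_normr_Rintegral => //; exact: integrable_sub mst (stab j) intim.
Qed.

End scalar_spaces.

(** * Integration by parts *)

Section integration_by_parts.
Variables (R : realType) (a b : R) (g : derivator a b).
Local Notation mu := (completed_stieltjes_measure g).
Local Notation T := (stieltjes_type g).
Local Notation J := (`[a, b[%classic : set T).

Let mJ : measurable J. Proof. exact: measurable_itvT. Qed.

Variables (F0 H0 : R) (f h : R -> R).
Hypothesis intf : mu.-integrable J (EFin \o f).
Hypothesis inth : mu.-integrable J (EFin \o h).

(** [F] models a function and [H] a posterior trace: the closed interval includes the atom at t. *)
Let F t := F0 + \int[mu]_(x in `[a, t[) f x.
Let H t := H0 + \int[mu]_(x in `[a, t]) h x.

Lemma integrable_affine_primitive_mul : mu.-integrable J (EFin \o (fun t => F t * h t)).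
Proof.
have := integrableD mJ (integrableZl mJ F0 inth) (integrable_primitive_mul intf inth).
by apply: eq_integrable => // t _ /=; rewrite -EFinM -EFinD /F mulrDl.
Qed.

(** The total integral minus the tail over ]t, b[ brings in the upper primitive, whose integrability
    and exchange formula are at hand. *)
Let closed_primitiveE t : t \in `[a, b[ ->
  f t * H t = (H0 + \int[mu]_(x in J) h x) * f t - \int[mu]_(x in `]t, b[) h x * f t.
Proof. by move=> tab; rewrite (Rintegral_split_upper inth tab) /H; ring. Qed.

Lemma integrable_mul_affine_primitive : mu.-integrable J (EFin \o (fun t => f t * H t)).
Proof.
have := integrableB mJ (integrableZl mJ (H0 + \int[mu]_(x in J) h x) intf)
  (integrable_upper_primitive_mul inth intf).
by apply: eq_integrable => // t /[1!inE]/= tab; rewrite closed_primitiveE// EFinB EFinM.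
Qed.

(** By [closed_primitiveE] the second integral contains, with a minus sign, the tail of [h] against
    [f]; by [Rintegral_primitive_upper] this cancels the primitive of [f] against [h] in the first.
    Only products of constants remain. *)
Lemma integration_by_parts_affine :
  \int[mu]_(t in J) (F t * h t) + \int[mu]_(t in J) (f t * H t) =
  (F0 + \int[mu]_(t in J) f t) * (H0 + \int[mu]_(t in J) h t) - F0 * H0.
Proof.
have intFh := integrable_primitive_mul intf inth.
have intup := integrable_upper_primitive_mul inth intf.
under eq_Rintegral do rewrite mulrDl.
rewrite (RintegralD mJ (integrableZl mJ F0 inth) intFh) (RintegralZl _ mJ inth).
rewrite Rintegral_primitive_upper//.
rewrite (@eq_Rintegral _ _ _ mu J (fun t => (H0 + \int[mu]_(x in J) h x) * f t -
  \int[mu]_(x in `]t, b[) h x * f t) (fun t => f t * H t)); last first.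
  by move=> t /[1!inE]/= tab; exact: closed_primitiveE.
rewrite (RintegralB mJ (integrableZl mJ _ intf) intup) (RintegralZl _ mJ intf).
ring.
Qed.

End integration_by_parts.

(** * Integration by parts and Sobolev primitives for real or complex scalars *)

Section scalar_integration_by_parts.
Variables (R : realType) (k : scalar_kind) (a b : R) (g : derivator a b).
Local Notation K := (scalar_field R k).
Local Notation mu := (completed_stieltjes_measure g).
Local Notation T := (stieltjes_type g).
Local Notation J := (`[a, b[%classic : set T).

Let mJ : measurable J. Proof. exact: measurable_itvT. Qed.

(** The real part is the real formula for the two real parts minus the one for the two imaginary
    parts; the imaginary part is the sum of the two mixed formulas. *)
Lemma integration_by_parts_g (V v Phi phi : R -> K) :
  is_stieltjes_deriv g V v -> is_stieltjes_deriv g Phi phi ->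
  integral_g g `[a, b[ (fun t => V t * phi t) +
    integral_g g `[a, b[ (fun t => v t * posterior_trace g Phi t) =
  V b * Phi b - V a * Phi a.
Proof.
move=> dV dPhi.
have [vr vi] := is_stieltjes_deriv_integrable dV.
have [pr pi] := is_stieltjes_deriv_integrable dPhi.
have ab := derivator_lt g.
have bab : b \in `[a, b] by rewrite in_itv/= lexx ltW.
have sub t : t \in `[a, b[ -> t \in `[a, b].
  by rewrite !in_itv/= => /andP[-> /ltW].
pose re_v x := scalar_re (v x); pose im_v x := scalar_im (v x).
pose re_phi x := scalar_re (phi x); pose im_phi x := scalar_im (phi x).
pose P F0 (f : R -> R) t := F0 + \int[mu]_(x in `[a, t[) f x.
pose Q H0 (h : R -> R) t := H0 + \int[mu]_(x in `[a, t]) h x.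
have VE t : t \in `[a, b[ ->
    (scalar_re (V t) = P (scalar_re (V a)) re_v t) /\
    (scalar_im (V t) = P (scalar_im (V a)) im_v t).
  move=> /sub tab; split; first exact: is_stieltjes_deriv_re.
  exact: is_stieltjes_deriv_im.
have SE t : t \in `[a, b[ ->
    (scalar_re (posterior_trace g Phi t) =
      Q (scalar_re (Phi a)) re_phi t) /\
    (scalar_im (posterior_trace g Phi t) =
      Q (scalar_im (Phi a)) im_phi t).
  move=> tab; rewrite (posterior_trace_primitive dPhi tab).
  by rewrite scalar_reD scalar_imD scalar_re_integral_g scalar_im_integral_g.
have intA F0 f h (intf : mu.-integrable J (EFin \o f))
    (inth : mu.-integrable J (EFin \o h)) :
    mu.-integrable J (EFin \o (fun t => P F0 f t * h t)).
  exact: integrable_affine_primitive_mul.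
have intB H0 f h (intf : mu.-integrable J (EFin \o f))
    (inth : mu.-integrable J (EFin \o h)) :
    mu.-integrable J (EFin \o (fun t => f t * Q H0 h t)).
  exact: integrable_mul_affine_primitive.
have ibp F0 H0 f h (intf : mu.-integrable J (EFin \o f))
    (inth : mu.-integrable J (EFin \o h)) :
    \int[mu]_(t in J) (P F0 f t * h t) + \int[mu]_(t in J) (f t * Q H0 h t) =
    (F0 + \int[mu]_(t in J) f t) * (H0 + \int[mu]_(t in J) h t) - F0 * H0.
  exact: integration_by_parts_affine.
have rrE := ibp (scalar_re (V a)) (scalar_re (Phi a)) _ _ vr pr.
have riE := ibp (scalar_re (V a)) (scalar_im (Phi a)) _ _ vr pi.
have irE := ibp (scalar_im (V a)) (scalar_re (Phi a)) _ _ vi pr.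
have iiE := ibp (scalar_im (V a)) (scalar_im (Phi a)) _ _ vi pi.
apply: scalar_eq; rewrite ?scalar_reD ?scalar_imD ?scalar_reN ?scalar_imN.
  rewrite !scalar_re_integral_g !scalar_reM.
  rewrite (is_stieltjes_deriv_re dV bab) (is_stieltjes_deriv_im dV bab).
  rewrite (is_stieltjes_deriv_re dPhi bab) (is_stieltjes_deriv_im dPhi bab).
  have -> : \int[mu]_(t in J) scalar_re (V t * phi t) =
      \int[mu]_(t in J) (P (scalar_re (V a)) re_v t * re_phi t) -
      \int[mu]_(t in J) (P (scalar_im (V a)) im_v t * im_phi t).
    rewrite -(RintegralB mJ (intA _ _ _ vr pr) (intA _ _ _ vi pi)).
    by apply: eq_Rintegral => t /[1!inE]/= /VE[<- <-]; rewrite scalar_reM.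
  have -> : \int[mu]_(t in J) scalar_re (v t * posterior_trace g Phi t) =
      \int[mu]_(t in J) (re_v t * Q (scalar_re (Phi a)) re_phi t) -
      \int[mu]_(t in J) (im_v t * Q (scalar_im (Phi a)) im_phi t).
    rewrite -(RintegralB mJ (intB _ _ _ vr pr) (intB _ _ _ vi pi)).
    by apply: eq_Rintegral => t /[1!inE]/= /SE[<- <-]; rewrite scalar_reM.
  by rewrite addrACA -opprD rrE iiE; ring.
rewrite !scalar_im_integral_g !scalar_imM.
rewrite (is_stieltjes_deriv_re dV bab) (is_stieltjes_deriv_im dV bab).
rewrite (is_stieltjes_deriv_re dPhi bab) (is_stieltjes_deriv_im dPhi bab).
have -> : \int[mu]_(t in J) scalar_im (V t * phi t) =
    \int[mu]_(t in J) (P (scalar_re (V a)) re_v t * im_phi t) +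
    \int[mu]_(t in J) (P (scalar_im (V a)) im_v t * re_phi t).
  rewrite -(RintegralD mJ (intA _ _ _ vr pi) (intA _ _ _ vi pr)).
  by apply: eq_Rintegral => t /[1!inE]/= /VE[<- <-]; rewrite scalar_imM.
have -> : \int[mu]_(t in J) scalar_im (v t * posterior_trace g Phi t) =
    \int[mu]_(t in J) (re_v t * Q (scalar_im (Phi a)) im_phi t) +
    \int[mu]_(t in J) (im_v t * Q (scalar_re (Phi a)) re_phi t).
  rewrite -(RintegralD mJ (intB _ _ _ vr pi) (intB _ _ _ vi pr)).
  by apply: eq_Rintegral => t /[1!inE]/= /SE[<- <-]; rewrite scalar_imM.
by rewrite addrACA riE irE; ring.
Qed.

Lemma is_stieltjes_deriv_primitive p (c : K) (w : R -> K) : (1 <= p)%E -> Lp_g g p w ->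
  is_stieltjes_deriv g (fun t => c + integral_g g `[a, t[ w) w.
Proof.
move=> p1 wp; split; first exact: Lp_g_sub wp.
by move=> t tab; rewrite set_itvco0 integral_g_set0 addr0.
Qed.

(** Membership in L^p comes from boundedness: [M] adds the components of [c] and the L^1 norms of
    those of [w]. *)
Lemma W1p_g_primitive p (c : K) (w : R -> K) : (1 <= p)%E -> Lp_g g p w ->
  W1p_g g p (fun t => c + integral_g g `[a, t[ w).
Proof.
move=> p1 wp; have dU := is_stieltjes_deriv_primitive c p1 wp.
split; [exact: is_stieltjes_deriv_AC dU| |by exists w].
have [wr wi] := Lp_g_integrable p1 wp.
have reE t : scalar_re (c + integral_g g `[a, t[ w) =
    scalar_re c + \int[mu]_(x in `[a, t[) scalar_re (w x).
  by rewrite scalar_reD scalar_re_integral_g.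
have imE t : scalar_im (c + integral_g g `[a, t[ w) =
    scalar_im c + \int[mu]_(x in `[a, t[) scalar_im (w x).
  by rewrite scalar_imD scalar_im_integral_g.
pose M := `|scalar_re c| + \int[mu]_(x in J) `|scalar_re (w x)| +
  (`|scalar_im c| + \int[mu]_(x in J) `|scalar_im (w x)|).
have mre : measurable_fun J (fun t => scalar_re (c + integral_g g `[a, t[ w)).
  have -> := funext reE.
  exact: measurable_funD (measurable_cst _) (measurable_primitive wr).
have mim : measurable_fun J (fun t => scalar_im (c + integral_g g `[a, t[ w)).
  have -> := funext imE.
  exact: measurable_funD (measurable_cst _) (measurable_primitive wi).
apply: (bounded_Lp_g (M := M) p1 mre mim).
move=> t; rewrite in_itv/= => /andP[_ /ltW tb].
have mt : measurable (`[a, t[%classic : set T) by exact: measurable_itvT.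
have subt := @subset_itv_initial _ a _ _ tb.
apply: le_trans (modulus_le _) _; rewrite reE imE.
apply: lerD; apply: (le_trans (ler_normD _ _)); rewrite lerD2l.
  exact: norm_Rintegral_sub mt subt wr.
exact: norm_Rintegral_sub mt subt wi.
Qed.

End scalar_integration_by_parts.

(** * Weak and strong formulations *)

Section weak_strong.
Variables (R : realType) (k : scalar_kind) (a b : R) (g : derivator a b).
Local Notation K := (scalar_field R k).
Local Notation mu := (completed_stieltjes_measure g).
Local Notation T := (stieltjes_type g).
Local Notation J := (`[a, b[%classic : set T).

Let mJ : measurable J. Proof. exact: measurable_itvT. Qed.

(** The real and imaginary parts of the difference of two versions have vanishing primitives. *)
Lemma is_stieltjes_deriv_unique (U w1 w2 : R -> K) :
  is_stieltjes_deriv g U w1 -> is_stieltjes_deriv g U w2 -> ae_eq_g g w1 w2.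
Proof.
move=> d1 d2.
have [r1 i1] := is_stieltjes_deriv_integrable d1.
have [r2 i2] := is_stieltjes_deriv_integrable d2.
have van (f h : R -> R) (intf : mu.-integrable J (EFin \o f))
    (inth : mu.-integrable J (EFin \o h)) :
    (forall t, t \in `[a, b] ->
      \int[mu]_(x in `[a, t[) f x = \int[mu]_(x in `[a, t[) h x) ->
    {ae mu, forall t, t \in `[a, b[ -> f t - h t = 0}.
  move=> fh; apply: vanishing_primitive_ae0 => [|t tab].
    exact: (integrableB mJ intf inth).
  have mt : measurable (`[a, t[%classic : set T) by exact: measurable_itvT.
  have subt : `[a, t[ `<=` `[a, b[.
    by apply: subset_itv_initial; move: tab; rewrite in_itv/= => /andP[].
  rewrite (RintegralB mt (integrable_sub mt subt intf) (integrable_sub mt subt inth)).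
  by rewrite fh// subrr.
have /van -/(_ r1 r2) re0 : forall t, t \in `[a, b] ->
    \int[mu]_(x in `[a, t[) scalar_re (w1 x) = \int[mu]_(x in `[a, t[) scalar_re (w2 x).
  move=> t tab; apply: (@addrI _ (scalar_re (U a))).
  by rewrite -(is_stieltjes_deriv_re d1 tab) -(is_stieltjes_deriv_re d2 tab).
have /van -/(_ i1 i2) im0 : forall t, t \in `[a, b] ->
    \int[mu]_(x in `[a, t[) scalar_im (w1 x) = \int[mu]_(x in `[a, t[) scalar_im (w2 x).
  move=> t tab; apply: (@addrI _ (scalar_im (U a))).
  by rewrite -(is_stieltjes_deriv_im d1 tab) -(is_stieltjes_deriv_im d2 tab).
apply: (@filterS2 _ _ (ae_completed_filter g) _ _ _ _ re0 im0) => t re0t im0t tab.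
by apply: scalar_eq; apply/eqP; rewrite -subr_eq0; [rewrite re0t|rewrite im0t].
Qed.

Lemma ae_eq_Rintegral (f h : R -> R) : measurable_fun J f -> measurable_fun J h ->
  {ae mu, forall t, t \in `[a, b[ -> f t = h t} ->
  \int[mu]_(t in J) f t = \int[mu]_(t in J) h t.
Proof.
move=> /measurable_EFinP mf /measurable_EFinP mh fh; rewrite /Rintegral; congr fine.
apply: (@ae_eq_integral _ T R mu J (EFin \o h) (EFin \o f) mJ mf mh).
apply: (@filterS _ _ (ae_completed_filter g) _ _ _ fh) => t fht /= tab.
by rewrite fht.
Qed.

Lemma integral_g_ae_eq (f1 f2 : R -> K) :
  measurable_fun J (fun t => scalar_re (f1 t)) ->
  measurable_fun J (fun t => scalar_im (f1 t)) ->
  measurable_fun J (fun t => scalar_re (f2 t)) ->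
  measurable_fun J (fun t => scalar_im (f2 t)) ->
  ae_eq_g g f1 f2 -> integral_g g `[a, b[ f1 = integral_g g `[a, b[ f2.
Proof.
move=> mr1 mi1 mr2 mi2 f12; apply: scalar_eq.
  rewrite !scalar_re_integral_g; apply: (ae_eq_Rintegral mr1 mr2).
  apply: (@filterS _ _ (ae_completed_filter g) _ _ _ f12) => t f12t tab.
  by rewrite f12t.
rewrite !scalar_im_integral_g; apply: (ae_eq_Rintegral mi1 mi2).
apply: (@filterS _ _ (ae_completed_filter g) _ _ _ f12) => t f12t tab.
by rewrite f12t.
Qed.

Lemma measurable_scalar_mul (f h : R -> K) :
  scalar_integrable g f -> scalar_integrable g h ->
  measurable_fun J (fun t => scalar_re (f t * h t)) /\
  measurable_fun J (fun t => scalar_im (f t * h t)).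
Proof.
move=> [/measurable_int/measurable_EFinP fr /measurable_int/measurable_EFinP fi].
move=> [/measurable_int/measurable_EFinP hr /measurable_int/measurable_EFinP hi].
split.
  rewrite (funext (fun t => scalar_reM (f t) (h t))).
  exact: measurable_funB (measurable_funM fr hr) (measurable_funM fi hi).
rewrite (funext (fun t => scalar_imM (f t) (h t))).
exact: measurable_funD (measurable_funM fr hi) (measurable_funM fi hr).
Qed.

(** A real-valued indicator as factor separates real and imaginary parts, and each is determined
    a.e. by its integrals over measurable sets. *)
Lemma ae_eq_g_of_integral (f1 f2 : R -> K) :
  scalar_integrable g f1 -> scalar_integrable g f2 ->
  (forall E : set T, measurable E -> E `<=` J ->
    integral_g g `[a, b[ (fun t => f1 t * mk_scalar k (\1_E t) 0) =
    integral_g g `[a, b[ (fun t => f2 t * mk_scalar k (\1_E t) 0)) ->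
  ae_eq_g g f1 f2.
Proof.
move=> [r1 i1] [r2 i2] f12.
have indic (f : R -> R) (E : set T) : measurable E -> E `<=` J ->
    mu.-integrable J (EFin \o f) ->
    (\int[mu]_(t in E) (f t)%:E)%E = (\int[mu]_(t in J) (f t * \1_E t))%:E.
  move=> mE EJ intf.
  rewrite -(fineK (integrable_fin_num mE (integrable_sub mE EJ intf))); congr EFin.
  rewrite -/(Rintegral mu E f) -(setIidr EJ) Rintegral_mkcondr.
  apply: eq_Rintegral => t _; rewrite patchE indicE setIidr//.
  by case: ifPn => _; rewrite ?mulr1 ?mulr0.
have re12 : ae_eq mu J (fun t => (scalar_re (f1 t))%:E)
    (fun t => (scalar_re (f2 t))%:E).
  apply: (@integral_ae_eq _ T R mu J mJ _ _ r1 (measurable_int _ r2)) => E EJ mE.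
  rewrite /= !indic//; congr EFin.
  have := congr1 (@scalar_re R k) (f12 E mE EJ); rewrite !scalar_re_integral_g.
  under eq_Rintegral do rewrite scalar_reM scalar_re_mk scalar_im_mk0 mulr0 subr0.
  by under [RHS]eq_Rintegral
    do rewrite scalar_reM scalar_re_mk scalar_im_mk0 mulr0 subr0.
have im12 : ae_eq mu J (fun t => (scalar_im (f1 t))%:E)
    (fun t => (scalar_im (f2 t))%:E).
  apply: (@integral_ae_eq _ T R mu J mJ _ _ i1 (measurable_int _ i2)) => E EJ mE.
  rewrite /= !indic//; congr EFin.
  have := congr1 (@scalar_im R k) (f12 E mE EJ); rewrite !scalar_im_integral_g.
  under eq_Rintegral do rewrite scalar_imM scalar_re_mk scalar_im_mk0 mulr0 add0r.
  by under [RHS]eq_Rintegral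
    do rewrite scalar_imM scalar_re_mk scalar_im_mk0 mulr0 add0r.
apply: (@filterS2 _ _ (ae_completed_filter g) _ _ _ _ re12 im12) => t re12t im12t tab.
by apply: scalar_eq; [have := re12t tab|have := im12t tab] => -[].
Qed.

Lemma indicator_Lp_g p (E : set T) : (1 <= p)%E -> measurable E ->
  Lp_g g p (fun t => mk_scalar k (\1_E t) 0).
Proof.
move=> p1 mE; apply: (bounded_Lp_g (M := 1) p1).
- have -> : (fun t => scalar_re (mk_scalar k (\1_E t) 0)) = (\1_E : T -> R).
    by apply/funext => t; rewrite scalar_re_mk.
  exact: measurable_indic.
- have -> : (fun t => scalar_im (mk_scalar k (\1_E t) 0)) = (cst 0 : T -> R).
    by apply/funext => t; rewrite scalar_im_mk0.
  exact: measurable_cst.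
- move=> t _; apply: le_trans (modulus_le _) _.
  rewrite scalar_re_mk scalar_im_mk0 normr0 addr0 indicE.
  by case: (t \in E); rewrite ?normr1 ?normr0.
Qed.

(** The one-interval case; since [AC_g] takes non-empty intervals only, s = t is treated apart. *)
Lemma AC_g_single (U : R -> K) (e : R) : AC_g g U -> 0 < e ->
  exists2 d, 0 < d & forall s t, a <= s -> s <= t -> t <= b -> g t - g s < d ->
    modulus (U t - U s) < e.
Proof.
move=> ACU e0; have [d d0 Ud] := ACU e e0.
exists d => // s t as_ st tb gst; move: st; rewrite le_eqVlt => /predU1P[->|st].
  by rewrite subrr /modulus normr0; case: k.
have := Ud 1%N (fun=> s) (fun=> t) (fun=> st); rewrite !big_ord1; apply => //.
  by move=> _; apply: subset_itv; rewrite bnd_simp.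
by move=> i j _ _ _; rewrite !ord1.
Qed.

Lemma AC_g_ae_eq (U V : R -> K) : AC_g g U -> AC_g g V -> ae_eq_g g V U ->
  V b = U b -> forall t, t \in `[a, b] -> V t = U t.
Proof.
move=> ACU ACV aeVU Vb t; rewrite in_itv/= => /andP[at_ tb].
have close e : 0 < e -> exists s, [/\ V s = U s,
    modulus (U s - U t) < e & modulus (V s - V t) < e].
  move=> e0; have [dU dU0 Ud] := AC_g_single ACU e0.
  have [dV dV0 Vd] := AC_g_single ACV e0.
  have d0 : 0 < Num.min dU dV by rewrite lt_min dU0.
  suff [s [ts sb gs VUs]] : exists s, [/\ t <= s, s <= b,
      g s - g t < Num.min dU dV & V s = U s].
    move: gs; rewrite lt_min => /andP[gU gV].
    by exists s; split => //; [exact: Ud|exact: Vd].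
  have [gtb|gbt] := ltP (g t) (g b); last first.
    by exists b; split => //; apply: le_lt_trans d0; rewrite subr_le0.
  have tltb : t < b.
    by rewrite lt_neqAle tb andbT; apply: contraTneq gtb => ->; rewrite ltxx.
  have tab : t \in `[a, b[ by rewrite in_itv/= at_ tltb.
  have [s [ts sb gs Ps]] := ae_near_right aeVU tab gtb d0.
  by exists s; split => //; exact: ltW.
have eq_of_close (x y : R) :
    (forall e, 0 < e -> exists z, `|z - x| < e /\ `|z - y| < e) -> x = y.
  move=> xy; apply/eqP; rewrite -subr_eq0 -normr_le0; apply/ler_addgt0Pr => e e0.
  have [z [zx zy]] := xy (e / 2) (divr_gt0 e0 (ltr0Sn _ 1)).
  rewrite add0r (le_trans (ler_distD z _ _))// (splitr e) lerD//; last exact: ltW.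
  by rewrite distrC ltW.
apply: scalar_eq; apply: eq_of_close => e /close[s [VUs Us Vs]].
  exists (scalar_re (V s)); split.
    by rewrite -scalar_reN -scalar_reD (le_lt_trans (norm_scalar_le_modulus _).1).
  by rewrite VUs -scalar_reN -scalar_reD (le_lt_trans (norm_scalar_le_modulus _).1).
exists (scalar_im (V s)); split.
  by rewrite -scalar_imN -scalar_imD (le_lt_trans (norm_scalar_le_modulus _).2).
by rewrite VUs -scalar_imN -scalar_imD (le_lt_trans (norm_scalar_le_modulus _).2).
Qed.

End weak_strong.

Unset Implicit Arguments.

Theorem theorem5p3 (R : realType) (k : scalar_kind) (a b : R)
    (g : derivator a b) (g_mass : 0 < g b - g a)
    (p : \bar R) (p_ge1 : (1 <= p)%E)
    (u v : R -> scalar_field R k) (Lp_u : Lp_g g p u) (Lp_v : Lp_g g p v)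
    (u_a u_b : scalar_field R k) :
  let U := fun t : R => u_a + integral_g g `[a, t[ v in
  let weak_formulation :=
    forall Phi : R -> scalar_field R k, W1p_g g (hoelder_conjugate p) Phi ->
    forall DPhi : R -> scalar_field R k, is_stieltjes_deriv g Phi DPhi ->
      integral_g g `[a, b[ (fun t => u t * DPhi t)
        + integral_g g `[a, b[ (fun t => v t * posterior_trace g Phi t)
      = u_b * Phi b - u_a * Phi a in
  let strong_formulation :=
    [/\ W1p_g g p U, ae_eq_g g U u, U a = u_a & U b = u_b] in
  (weak_formulation <-> strong_formulation) /\
  (strong_formulation ->
    (forall DU : R -> scalar_field R k, is_stieltjes_deriv g U DU ->
       ae_eq_g g DU v) /\
    (forall V : R -> scalar_field R k,
       W1p_g g p V -> ae_eq_g g V u -> V a = u_a -> V b = u_b ->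
       forall t, t \in `[a, b] -> V t = U t)).
Proof.
move=> U weak strong.
have dU : is_stieltjes_deriv g U v by exact: is_stieltjes_deriv_primitive p_ge1 Lp_v.
have WU : W1p_g g p U by exact: W1p_g_primitive.
have Ua : U a = u_a by rewrite /U set_itvco0 integral_g_set0 addr0.
have q_ge1 := hoelder_conj_ge1 p_ge1.
have int_u := Lp_g_integrable p_ge1 Lp_u.
have int_U : scalar_integrable g U by case: WU => _ /(Lp_g_integrable p_ge1).
(* These indicators will be the derivatives of the test functions; being bounded, they are
   admissible for every conjugate exponent. *)
pose chi (E : set (stieltjes_type g)) t := mk_scalar k (\1_E t : R) 0.
split; first split.
- move=> weak_u.
  (* Subtract integration by parts for [U] from the weak formulation, with Phi = c + int chi: the
     terms in S Phi and Phi(a) cancel, and the last factor is Phi(b). *)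
  have test E c : measurable E ->
      integral_g g `[a, b[ (fun t => u t * chi E t) -
      integral_g g `[a, b[ (fun t => U t * chi E t) =
      (u_b - U b) * (c + integral_g g `[a, b[ (chi E)).
    move=> mE; have LE := indicator_Lp_g k q_ge1 mE.
    have dPhi := is_stieltjes_deriv_primitive c q_ge1 LE.
    have := weak_u _ (W1p_g_primitive c q_ge1 LE) _ dPhi.
    have := integration_by_parts_g dU dPhi; rewrite Ua.
    move=> /(canRL (addrK _)) -> /(canRL (addrK _)) ->.
    by rewrite /chi; ring.
  have uU E : measurable E -> integral_g g `[a, b[ (fun t => u t * chi E t) =
      integral_g g `[a, b[ (fun t => U t * chi E t).
    move=> mE; apply/eqP; rewrite -subr_eq0.
    (* This constant makes Phi(b) = 0. *)
    by rewrite (test E (- integral_g g `[a, b[ (chi E)))// addNr mulr0.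
  split => //.
    by apply: ae_eq_g_of_integral => // E mE _; rewrite -/(chi E) uU.
  (* Now D Phi = 0, and the constant gives Phi(b) = 1 without evaluating the integral of [chi set0];
     by [uU] the left side is 0. *)
  have := test set0 (1 - integral_g g `[a, b[ (chi set0)) measurable0.
  by rewrite uU// subrr subrK mulr1 => /esym/eqP; rewrite subr_eq0 => /eqP.
(* Integration by parts for [U] is the weak identity with [U] in place of [u]; only the first
   integral differs, and there the two agree a.e. *)
- move=> [_ Uu _ Ub] Phi _ DPhi dPhi.
  rewrite -Ub -[u_a]Ua -(integration_by_parts_g dU dPhi); congr (_ + _).
  have int_DPhi := is_stieltjes_deriv_integrable dPhi.
  have [mr mi] := measurable_scalar_mul int_u int_DPhi.
  have [mr' mi'] := measurable_scalar_mul int_U int_DPhi.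
  apply: integral_g_ae_eq => //.
  apply: (@filterS _ _ (ae_completed_filter g) _ _ _ Uu).
  by move=> t Uut tab; rewrite Uut.
- move=> [_ Uu _ Ub]; split=> [DU dDU|V [ACV _ _] Vu _ Vb].
    exact: is_stieltjes_deriv_unique dDU dU.
  have [ACU _ _] := WU.
  apply: (AC_g_ae_eq ACU ACV); last by rewrite Vb Ub.
  apply: (@filterS2 _ _ (ae_completed_filter g) _ _ _ _ Uu Vu) => t Uut Vut tab.
  by rewrite Vut// Uut.
Qed.
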